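(* Let $\ell\ge 3$ be a prime. There is no $a\in\mathbb{Z}$ such that $\overline{p}(\ell n+a)\equiv 0\pmod{\ell}$ for all $n\in\mathbb{Z}$.
   Context: An overpartition of $n$ is a representation of $n$ as a sum of non-increasing positive integers in which the first occurrence of each integer may be overlined. $\overline{p}(n)$ is the number of overpartitions of $n$, with $\overline{p}(0)=1$ and $\overline{p}(n)=0$ for $n<0$. *)

(* Defs.v *)
From mathcomp Require Import all_boot all_algebra.

Set Implicit Arguments.
Unset Strict Implicit.
Unset Printing Implicit Defensive.

(* An overpartition is a sequence of pairs (part, is it overlined?); an
   overlined entry must be the first occurrence of its value among the parts. *)
Definition is_overpartition (n : nat) (s : seq (nat * bool)) : bool :=
  let parts := unzip1 s in
  [&& sorted geq parts, all (leq 1) parts, sumn parts == n &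
      all (fun i => nth false (unzip2 s) i ==> (index (nth 0 parts i) parts == i))
          (iota 0 (size s))].

Definition forget_bound (n : nat) (s : seq ('I_n.+1 * bool)) :
  seq (nat * bool) := [seq (val x.1, x.2) | x <- s].

(* The parts of an overpartition of n are at most n, and there are at most n
   of them; [num_overpartitionsE] shows that these bounds lose nothing. *)
Definition num_overpartitions (n : nat) : nat :=
  #|[set s : {bseq n of 'I_n.+1 * bool} | is_overpartition n (forget_bound s)]|.

Definition pbar (z : int) : nat :=
  match z with
  | Posz n => num_overpartitions n
  | Negz _ => 0
  end.

Lemma overpartition_size n s : is_overpartition n s -> size s <= n.
Proof.
case/and4P=> _ /allP pos /eqP <- _; rewrite -(size_map fst) -/(unzip1 s).
elim: (unzip1 s) pos => //= x t IH pos.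
rewrite -add1n leq_add ?pos ?mem_head // IH // => y yt.
by rewrite pos // in_cons yt orbT.
Qed.

Lemma overpartition_le n s x : is_overpartition n s -> x \in s -> x.1 <= n.
Proof.
case/and4P=> _ _ /eqP <- _ /(map_f fst); rewrite -/(unzip1 s).
elim: (unzip1 s) => //= y t IH; rewrite in_cons => /predU1P[->|/IH h].
  exact: leq_addr.
exact: leq_trans h (leq_addl _ _).
Qed.

Lemma num_overpartitionsE n (e : seq (seq (nat * bool))) :
  uniq e -> (forall s, (s \in e) = is_overpartition n s) ->
  num_overpartitions n = size e.
Proof.
move=> Ue He; rewrite /num_overpartitions cardE.
set A := enum _.
have finj : injective (fun s : {bseq n of 'I_n.+1 * bool} => forget_bound s).
  move=> s t /= h; apply: val_inj => /=; apply: inj_map h => -[a b] [c d] /= [].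
  by move=> /val_inj -> ->.
rewrite -(size_map (fun s : {bseq n of 'I_n.+1 * bool} => forget_bound s)).
apply: perm_size; apply: uniq_perm; rewrite ?(map_inj_uniq finj) ?enum_uniq //.
move=> s; rewrite He; apply/mapP/idP => [[t + ->]|hs].
  by rewrite mem_enum inE.
pose t := [seq (inord x.1 : 'I_n.+1, x.2) | x <- s].
have ht : size t <= n by rewrite size_map; apply: overpartition_size hs.
have Et : s = forget_bound t.
  rewrite /forget_bound -map_comp -[LHS]map_id; apply/eq_in_map => -[a b] xs /=.
  by rewrite inordK // ltnS; apply: (overpartition_le hs xs).
by exists (Bseq ht); rewrite // mem_enum inE /= -Et.
Qed.

(* Main.v *)
(* Let P be the generating function of overpartitions and l = 2m+1. By Gauss,
   P = 1/theta with theta = sum of (-1)^k q^(k^2) over the integers k; write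
   A = theta(-q)^2, B = theta(q)^2 and D = q d/dq. Passing from q to q^2
   replaces (A, B) by their arithmetic and geometric means. Hence two identities
   can be proved by comparing a series with its value at q^2:
   2 (A'B - AB') = AB(A^2 - B^2) for ' = D, and, modulo l, the homogeneous Hasse
   polynomial sum_j binom(m,j)^2 A^(2j) B^(2(m-j)) is a nonzero constant c.
   With rho = A^2/B^2 and G(x) = sum_j binom(m,j)^2 x^j this says
   D rho = rho (rho-1) theta^4 and theta^(4m) G(rho) = c, so that
   D^j P = P theta^(4j(m+1)) p_j(rho) for explicit polynomials p_j.
   The roots of G (the supersingular points) are simple, since G solves a
   hypergeometric equation, and the recursion gives p_(m+1) <> 0 at them.
   If P vanished modulo l on a class a <> 0, then sum_(i<2m) a^i D^(2m-i) P = 0.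
   Since w = theta^(-4) satisfies the Eisenstein equation c w^m = G(rho), the
   powers 1, w, ..., w^(m-1) are independent over the polynomials in rho, and the
   relation splits into relations between p_(i+m) and p_i. The one for i = 1
   says that G divides p_(m+1), a contradiction. *)

From HB Require Import structures.
Require Import Defs.
From mathcomp Require Import all_boot all_algebra.
From mathcomp Require Import closed_field boolp ring zify.

Set Implicit Arguments.
Unset Strict Implicit.
Unset Printing Implicit Defensive.

Import GRing.Theory.

Local Open Scope ring_scope.

(** * Formal power series *)

(** The wrapper gives series a ring structure of their own; equality and choice on them are
    classical. *)
Record fps (R : Type) := Fps { fcoef :> nat -> R }.

HB.instance Definition _ (R : Type) := gen_eqMixin (fps R).
HB.instance Definition _ (R : Type) := gen_choiceMixin (fps R).

Lemma fpsP (R : Type) (f g : fps R) : (forall n, f n = g n) -> f = g.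
Proof. by case: f g => [f] [g] /= /funext ->. Qed.

Section FpsRing.
Variable R : comNzRingType.
Implicit Types (f g h : fps R) (p : {poly R}).

Definition ftrunc (N : nat) f : {poly R} := \poly_(i < N.+1) f i.

Lemma coef_ftrunc N f i : (i <= N)%N -> (ftrunc N f)`_i = f i.
Proof. by move=> leiN; rewrite coef_poly ltnS leiN. Qed.

Definition fadd f g := Fps (fun n => f n + g n).
Definition fopp f := Fps (fun n => - f n).
Definition fmul f g := Fps (fun n => \sum_(i < n.+1) f i * g (n - i)%N).
Definition fconst (c : R) : fps R := Fps (fun n => if n == 0%N then c else 0).

Fact faddA : associative fadd.
Proof. by move=> f g h; apply: fpsP => n /=; rewrite addrA. Qed.
Fact faddC : commutative fadd.
Proof. by move=> f g; apply: fpsP => n /=; rewrite addrC. Qed.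
Fact fadd0 : left_id (fconst 0) fadd.
Proof. by move=> f; apply: fpsP => n /=; rewrite if_same add0r. Qed.
Fact faddN : left_inverse (fconst 0) fopp fadd.
Proof. by move=> f; apply: fpsP => n /=; rewrite if_same addNr. Qed.

HB.instance Definition _ :=
  GRing.isZmodule.Build (fps R) faddA faddC fadd0 faddN.

(** Only the coefficients up to [n] of the factors matter, so the ring laws of series are inherited
    from polynomials by truncation. *)
Lemma fmul_coef_poly f g p (r : {poly R}) n :
  (forall i, (i <= n)%N -> p`_i = f i) -> (forall i, (i <= n)%N -> r`_i = g i) ->
  fmul f g n = (p * r)`_n.
Proof.
move=> Ef Eg; rewrite coefM; apply: eq_bigr => i _.
by rewrite Ef ?Eg ?leq_subr // -ltnS.
Qed.

Fact fmulA : associative fmul.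
Proof.
move=> f g h; apply: fpsP => n.
have E (u v : fps R) i : (i <= n)%N -> (ftrunc n u * ftrunc n v)`_i = fmul u v i.
  move=> lein; symmetry; apply: fmul_coef_poly => j /leq_trans/(_ lein);
  exact: coef_ftrunc.
rewrite (@fmul_coef_poly _ _ (ftrunc n f) (ftrunc n g * ftrunc n h)) //.
- by rewrite mulrA; symmetry; apply: fmul_coef_poly => i; [exact: E|exact: coef_ftrunc].
- by move=> i; apply: coef_ftrunc.
- by move=> i; apply: E.
Qed.
Fact fmulC : commutative fmul.
Proof.
move=> f g; apply: fpsP => n.
rewrite (@fmul_coef_poly _ _ (ftrunc n f) (ftrunc n g)) 1?mulrC;
  try by move=> i; apply: coef_ftrunc.
by symmetry; apply: fmul_coef_poly => i; apply: coef_ftrunc.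
Qed.
Fact fmul1 : left_id (fconst 1) fmul.
Proof.
move=> f; apply: fpsP => n /=; rewrite big_ord_recl mul1r subn0 big1 ?addr0 //.
by move=> i _; rewrite mul0r.
Qed.
Fact fmulDl : left_distributive fmul fadd.
Proof.
by move=> f g h; apply: fpsP => n /=; rewrite -big_split; apply: eq_bigr => i _; rewrite mulrDl.
Qed.
Fact fone_neq0 : fconst 1 != fconst 0.
Proof. by apply/eqP => /(congr1 (@fcoef _)) /(congr1 (@^~ 0%N)) /eqP; rewrite /= oner_eq0. Qed.

HB.instance Definition _ :=
  GRing.Zmodule_isComNzRing.Build (fps R) fmulA fmulC fmul1 fmulDl fone_neq0.

Lemma fcoefD f g n : (f + g) n = f n + g n. Proof. by []. Qed.
Lemma fcoefB f g n : (f - g) n = f n - g n. Proof. by []. Qed.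
Lemma fcoef0 n : (0 : fps R) n = 0. Proof. by rewrite /= if_same. Qed.
Lemma fcoef1 n : (1 : fps R) n = (n == 0%N)%:R. Proof. by rewrite /=; case: eqP. Qed.
Lemma fcoefM f g n : (f * g) n = \sum_(i < n.+1) f i * g (n - i)%N.
Proof. by []. Qed.
Lemma fcoefM0 f g : (f * g) 0%N = f 0%N * g 0%N.
Proof. by rewrite fcoefM big_ord1. Qed.
Lemma fcoefM1 f g : (f * g) 1%N = f 0%N * g 1%N + f 1%N * g 0%N.
Proof. by rewrite fcoefM !big_ord_recr big_ord0 /= add0r. Qed.

Lemma fcoef_sum (I : Type) (r : seq I) (Q : pred I) (F : I -> fps R) n :
  (\sum_(i <- r | Q i) F i) n = \sum_(i <- r | Q i) F i n.
Proof. exact: (big_morph (fun f : fps R => f n) (fun f g => fcoefD f g n) (fcoef0 n)). Qed.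

Fact fconst_additive : zmod_morphism fconst.
Proof.
by move=> a b; apply: fpsP => n; rewrite fcoefB /=; case: eqP => _ //; rewrite subr0.
Qed.
Fact fconst_mult : monoid_morphism fconst.
Proof.
split=> // a b; apply: fpsP => n; rewrite fcoefM /= big_ord_recl subn0 /= big1 => [|i _].
  by rewrite addr0; case: eqP => _ //; rewrite mulr0.
by rewrite mul0r.
Qed.
HB.instance Definition _ := GRing.isZmodMorphism.Build R (fps R) fconst fconst_additive.
HB.instance Definition _ := GRing.isMonoidMorphism.Build R (fps R) fconst fconst_mult.

Lemma fcoefZ c f n : (fconst c * f) n = c * f n.
Proof.
by rewrite fcoefM big_ord_recl subn0 big1 ?addr0 // => i _; rewrite mul0r.
Qed.
Lemma fcoefXn0 f n : (f ^+ n) 0%N = f 0%N ^+ n.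
Proof. by elim: n => // n IH; rewrite !exprS fcoefM0 IH. Qed.

Definition fvar : fps R := Fps (fun n => (n == 1%N)%:R).

Lemma fcoefXM f n : (fvar * f) n = if n is k.+1 then f k else 0.
Proof.
case: n => [|n]; first by rewrite fcoefM0 /= mul0r.
rewrite fcoefM big_ord_recl mul0r add0r big_ord_recl /= mul1r subSS subn0.
by rewrite big1 ?addr0 // => i _; rewrite mul0r.
Qed.
Lemma fcoefXnM f k n : (fvar ^+ k * f) n = if (n < k)%N then 0 else f (n - k)%N.
Proof.
elim: k n => [|k IH] n; first by rewrite expr0 mul1r subn0.
by rewrite exprS -mulrA fcoefXM; case: n => [|n] //; rewrite IH.
Qed.
Lemma fcoefXn k n : (fvar ^+ k) n = (n == k)%:R.
Proof. by rewrite -[fvar ^+ k]mulr1 fcoefXnM fcoef1 subn_eq0 eqn_leq ltnNge; case: (k <= n)%N; rewrite ?andbT ?andbF. Qed.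

(** Congruence modulo [q ^ (N + 1)]. *)
Definition feqm (N : nat) f g := forall n, (n <= N)%N -> f n = g n.

Lemma feqmM N f f' g g' : feqm N f f' -> feqm N g g' -> feqm N (f * g) (f' * g').
Proof.
move=> Ef Eg n len; rewrite !fcoefM; apply: eq_bigr => i _.
have lein: (i <= n)%N by rewrite -ltnS.
by rewrite Ef ?Eg ?(leq_trans _ len) // leq_subr.
Qed.

(** The derivation [q d/dq], which, unlike [d/dq], acts diagonally on the coefficients. *)
Definition fD f : fps R := Fps (fun n => n%:R * f n).

Lemma fcoef_fD f n : fD f n = n%:R * f n. Proof. by []. Qed.

Fact fD_additive : zmod_morphism fD.
Proof. by move=> f g; apply: fpsP => n; rewrite fcoefB /= mulrBr. Qed.
HB.instance Definition _ := GRing.isZmodMorphism.Build (fps R) (fps R) fD fD_additive.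

Lemma fDM f g : fD (f * g) = fD f * g + f * fD g.
Proof.
apply: fpsP => n; rewrite fcoefD /= mulr_sumr -big_split; apply: eq_bigr => i _ /=.
rewrite -{1}(@subnK i n) ?natrD; last by rewrite -ltnS.
by ring.
Qed.
Lemma fD_const c : fD (fconst c) = 0.
Proof. by apply: fpsP => -[|n]; rewrite fcoef0 /= ?mul0r ?mulr0. Qed.
Lemma fD1 : fD 1 = 0. Proof. exact: (fD_const 1). Qed.
Lemma fDX f n : fD (f ^+ n.+1) = n.+1%:R * f ^+ n * fD f.
Proof.
elim: n => [|n IH]; first by rewrite expr1 expr0 !mul1r.
by rewrite exprS fDM IH exprS -!natr1; ring.
Qed.

(** The substitution of [q ^ 2] for [q]. *)
Definition fsub2 f : fps R := Fps (fun n => if odd n then 0 else f n./2).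

Lemma fcoef_sub2 f n : fsub2 f n = if odd n then 0 else f n./2.
Proof. by []. Qed.

Lemma coef_fsub2_poly N f i :
  (i <= N)%N -> (ftrunc N f \Po 'X^2)`_i = fsub2 f i.
Proof.
move=> leiN; rewrite coef_comp_poly_Xn // dvdn2 divn2 coef_ftrunc /=; last by lia.
by case: odd.
Qed.

Fact fsub2_additive : zmod_morphism fsub2.
Proof. by move=> f g; apply: fpsP => n; rewrite fcoefB /=; case: odd => //; rewrite subr0. Qed.
Fact fsub2_mult : monoid_morphism fsub2.
Proof.
split; first by apply: fpsP => -[|[|n]] //=; case: odd; rewrite ?fcoef0.
move=> f g; apply: fpsP => n; symmetry.
rewrite (@fmul_coef_poly _ _ (ftrunc n f \Po 'X^2) (ftrunc n g \Po 'X^2));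
  try exact: coef_fsub2_poly.
rewrite -comp_polyM coef_comp_poly_Xn // dvdn2 divn2 /=; case: odd => //=.
by symmetry; apply: fmul_coef_poly => i lei; apply: coef_ftrunc; lia.
Qed.
HB.instance Definition _ := GRing.isZmodMorphism.Build (fps R) (fps R) fsub2 fsub2_additive.
HB.instance Definition _ := GRing.isMonoidMorphism.Build (fps R) (fps R) fsub2 fsub2_mult.

Lemma fD_sub2 f : fD (fsub2 f) = fsub2 (fD f) *+ 2.
Proof.
apply: fpsP => n; rewrite mulr2n fcoefD /=; case: ifPn => [_|/negbTE oddn]; first by rewrite mulr0 addr0.
by rewrite -mulrDl -natrD addnn; congr (_%:R * _); lia.
Qed.

(** A positive index is either odd, where the coefficient is 0, or can be replaced by its half,
    which is positive and smaller. *)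
Lemma fsub2_fixed f : f = fsub2 f -> f = fconst (f 0%N).
Proof.
move=> Ef; apply: fpsP; elim/ltn_ind => -[//|n] IH.
have -> : f n.+1 = fsub2 f n.+1 by rewrite -Ef.
rewrite /=; case: ifP => // oddn; rewrite IH; last by lia.
by rewrite /=; case: ifP => //; lia.
Qed.

End FpsRing.

Lemma fmul_eq0_unit (R : idomainType) (f g : fps R) : f 0%N != 0 -> f * g = 0 -> g = 0.
Proof.
move=> f0 fg0; apply: fpsP; elim/ltn_ind => n IH.
have: (f * g) n = 0 by rewrite fg0 fcoef0.
rewrite fcoefM big_ord_recl subn0 big1 ?addr0 => [/eqP|i _].
  by rewrite mulf_eq0 (negPf f0) fcoef0 => /eqP.
by rewrite IH ?fcoef0 ?mulr0 //= /bump; have := ltn_ord i; lia.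
Qed.

(** * The generating function of overpartitions *)

(* This relation is transitive, so that the condition on overlined entries
   becomes local. *)
Definition follows (p p' : nat * bool) : bool :=
  if p'.2 then (p'.1 < p.1)%N else (p'.1 <= p.1)%N.

Lemma follows_trans : transitive follows.
Proof.
by move=> [y b] [x a] [z c]; rewrite /follows /=; case: b; case: c; lia.
Qed.

(** In a non-increasing list equal parts are adjacent, so an overlined entry is a first occurrence
    exactly when its predecessor, if any, is strictly larger. *)
Lemma is_overpartitionE n s :
  is_overpartition n s =
  [&& sorted follows s, all (leq 1) (unzip1 s) & sumn (unzip1 s) == n].
Proof.
rewrite /is_overpartition.
set pt := unzip1 s; set ov := unzip2 s.
have Efst i : (i < size s)%N -> nth 0%N pt i = (nth (0%N, false) s i).1.
  by move=> lti; rewrite (nth_map (0%N, false)).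
have Esnd i : (i < size s)%N -> nth false ov i = (nth (0%N, false) s i).2.
  by move=> lti; rewrite (nth_map (0%N, false)).
have szp : size pt = size s by rewrite size_map.
suff E : sorted geq pt && all (fun i => nth false ov i ==> (index (nth 0%N pt i) pt == i))
          (iota 0 (size s)) = sorted follows s.
  by rewrite -E -andbA; congr (_ && _); rewrite [RHS]andbCA; congr (_ && _); rewrite andbC.
have geq_trans : transitive geq by move=> a b c /= h1 h2; exact: leq_trans h2 h1.
apply/andP/idP => [[sp /allP fp]|sf].
  apply/(sortedP (0%N, false)) => i lti.
  have lti' := ltnW lti.
  move/(sortedP 0%N)/(_ i): sp; rewrite szp => /(_ lti) /=; rewrite !Efst // => le.
  have := fp i.+1; rewrite mem_iota /= add0n => /(_ lti); rewrite Esnd // Efst // /follows.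
  case: ifP => //= _ /eqP ix; rewrite ltn_neqAle le andbT; apply/eqP => E.
  have : (index (nth (0%N, false) s i.+1).1 pt <= i)%N.
    by rewrite E -Efst // -ltnS ltnNge; apply/negP => /(before_find 0%N) /=; rewrite eqxx.
  by rewrite ix ltnn.
have R i j : (i < j < size s)%N -> follows (nth (0%N, false) s i) (nth (0%N, false) s j).
  case/andP=> ltij ltj; apply: (sorted_ltn_nth follows_trans) => //; rewrite inE //.
  exact: ltn_trans ltj.
split.
  apply/(sortedP 0%N) => i; rewrite szp => lti /=.
  have := R i i.+1; rewrite ltnSn lti => /(_ isT); rewrite !Efst ?(ltnW lti) // /follows.
  by case: ifP => // _ /ltnW.
apply/allP => i; rewrite mem_iota /= add0n => lti; rewrite Esnd //; apply/implyP => oi.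
have inp : nth 0%N pt i \in pt by rewrite mem_nth ?szp.
rewrite eqn_leq; apply/andP; split.
  by rewrite -ltnS ltnNge; apply/negP => /(before_find 0%N) /=; rewrite eqxx.
rewrite leqNgt; apply/negP => ltx.
have := R (index (nth 0%N pt i) pt) i; rewrite ltx lti => /(_ isT); rewrite /follows oi.
by rewrite -!Efst ?(ltn_trans ltx) // nth_index // ltnn.
Qed.

Definition enumerates (T : eqType) (e : seq T) (Q : pred T) :=
  uniq e /\ forall x, (x \in e) = Q x.

(** The entry [p] is a virtual head: it bounds the parts and forbids overlining its own value. *)
Definition ofweight (n : nat) (p : nat * bool) (s : seq (nat * bool)) :=
  [&& path follows p s, all (leq 1) (unzip1 s) & sumn (unzip1 s) == n].

Section Count.
Variable R : comNzRingType.
Local Notation q := (fvar R).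

Definition geo (k : nat) : fps R := Fps (fun n => (k %| n)%N%:R).

Lemma geoE k : (0 < k)%N -> (1 - q ^+ k) * geo k = 1.
Proof.
move=> k_gt0; apply: fpsP => n.
rewrite mulrBl mul1r fcoefB fcoefXnM fcoef1 /=.
case: ltnP => [ltnk|lekn].
  rewrite subr0; congr (_%:R); case: n ltnk => [|n] ltnk //=.
    by rewrite dvdn0.
  by rewrite gtnNdvd.
by rewrite dvdn_subl // subrr; case: n lekn; first by rewrite leqNgt k_gt0.
Qed.

(* Generating function of the overpartitions with parts at most [k]. *)
Fixpoint opgf (k : nat) : fps R :=
  if k is k'.+1 then (1 + q ^+ k'.+1) * (geo k'.+1 * opgf k') else 1.

(* The lists that may follow [(k.+1, true)] have parts at most [k.+1] and do not
   overline [k.+1]; those without [k.+1] are all the lists with parts at most [k]. *)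
Lemma enum_step k n :
  (forall n, exists e, enumerates e (fun s => ofweight n (k.+1, true) s && (k.+1 \notin unzip1 s))
     /\ (size e)%:R = opgf k n) ->
  exists e, enumerates e (ofweight n (k.+1, true))
     /\ (size e)%:R = (geo k.+1 * opgf k) n.
Proof.
move=> H; elim/ltn_ind: n => n IH.
have [e0 [[U0 E0] S0]] := H n.
(* A list either avoids [k.+1] or begins with a plain [k.+1], whose removal leaves a list of the
   same kind and of smaller weight. *)
have Eg : geo k.+1 * opgf k = opgf k + q ^+ k.+1 * (geo k.+1 * opgf k).
  by rewrite -[X in _ = X + _]mul1r -(@geoE k.+1) //; ring.
rewrite Eg fcoefD fcoefXnM -S0.
have hd s : ofweight n (k.+1, true) s -> k.+1 \in unzip1 s ->
    exists s', s = (k.+1, false) :: s'.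
  case: s => [|[x b] s]; rewrite /ofweight //=; case/and3P=> /andP[f pth] _ _.
  move=> kin; exists s; congr (_ :: _); move: f; rewrite /follows /=.
  case: b pth => pth h; last first.
    congr (_, _); apply/eqP; rewrite eqn_leq h /=.
    move: kin; rewrite in_cons => /orP[/eqP <- //|/mapP[[y c] yin /= ->]].
    move: pth; rewrite (path_sortedE follows_trans) => /andP[/allP/(_ _ yin) + _].
    by rewrite /follows /=; case: c {yin}; lia.
  move: kin; rewrite in_cons => /orP[/eqP E|/mapP[[y c] yin /= E]]; first by lia.
  move: pth; rewrite (path_sortedE follows_trans) => /andP[/allP/(_ _ yin) + _].
  by rewrite /follows /=; case: c {yin}; lia.
case: ltnP => ltnk.
  exists e0; split; last by rewrite addr0.
  split=> // s; rewrite E0 andb_idr // => ws; apply/negP => kin.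
  have [s' Es] := hd _ ws kin; move: ws; rewrite Es /ofweight /= => /and3P[_ _]; lia.
have [] := IH (n - k.+1)%N; first by lia.
move=> e1 [[U1 E1] S1].
exists (e0 ++ map (cons (k.+1, false)) e1); split; last first.
  by rewrite size_cat size_map natrD S1.
split.
  rewrite cat_uniq U0 map_inj_uniq ?U1 ?andbT /=; last by move=> ? ? [].
  apply/hasPn => s /mapP[s' _ ->]; rewrite E0 negb_and negbK.
  by rewrite inE eqxx orbT.
move=> s; rewrite mem_cat E0; apply/orP/idP => [[/andP[] //|/mapP[s' s'in ->]]|ws].
  move: s'in; rewrite E1 /ofweight /= => /and3P[pth -> /eqP ->].
  rewrite {1}/follows /= leqnn subnKC // eqxx !andbT /=.
  move: pth; rewrite !(path_sortedE follows_trans) => /andP[h ->]; rewrite andbT.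
  by apply: sub_all h => -[x b]; rewrite /follows /=; case: b.
case: (boolP (k.+1 \in unzip1 s)) => kin; last by left; rewrite ws.
right; have [s' Es] := hd _ ws kin; rewrite Es; apply: map_f; rewrite E1.
move: ws; rewrite Es /ofweight /= => /and3P[/andP[_ pth] -> /eqP <-].
rewrite addKn eqxx !andbT.
move: pth; rewrite !(path_sortedE follows_trans) => /andP[h ->]; rewrite andbT.
by apply: sub_all h => -[x b]; rewrite /follows /=; case: b; lia.
Qed.

Lemma path_notin k s :
  path follows (k.+1, true) s && (k.+1 \notin unzip1 s) =
  sorted follows s && all (fun p => p.1 <= k)%N s.
Proof.
rewrite (path_sortedE follows_trans) andbAC andbC; congr (_ && _).
elim: s => //= -[x b] s <-; rewrite in_cons negb_or /follows /=.
case: b; rewrite [RHS]andbCA; case: (all _ _); rewrite ?andbF //=; case: (_ \notin _);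
 rewrite ?andbF ?andbT //; lia.
Qed.

(** Lists with parts at most [k.+1] arise from those that do not overline [k.+1] by optionally
    prefixing an overlined [k.+1], whence the factor [1 + q ^ k.+1] of [opgf]. *)
Lemma opgf_enum k n :
  exists e, enumerates e (fun s => ofweight n (k.+1, true) s && (k.+1 \notin unzip1 s))
     /\ (size e)%:R = opgf k n.
Proof.
elim: k n => [|k IH] n.
  exists (if n == 0%N then [:: [::]] else [::]); split; last first.
    have -> : opgf 0 n = (n == 0%N)%:R by exact: fcoef1.
    by case: eqP.
  split=> [|s]; first by case: ifP.
  have -> : (s \in (if n == 0%N then [:: [::]] else [::])) = (n == 0%N) && (s == [::]).
    by case: eqP; rewrite ?mem_seq1.
  rewrite /ofweight andbAC path_notin -andbA; case: s => [|[x b] s] /=.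
    by rewrite eq_sym andbT.
  by rewrite leqn0 andbF; case: x => [|x]; rewrite /= ?andbF.
have F m := @enum_step k m IH.
have -> : opgf k.+1 = geo k.+1 * opgf k + q ^+ k.+1 * (geo k.+1 * opgf k).
  by rewrite -[LHS]/(_ * _) mulrDl mul1r.
rewrite fcoefD fcoefXnM.
have [e0 [[U0 E0] S0]] := F n.
have E s : ofweight n (k.+2, true) s && (k.+2 \notin unzip1 s) =
   ofweight n (k.+1, true) s ||
   (if s is p :: s' then [&& p == (k.+1, true), (k.+1 <= n)%N & ofweight (n - k.+1) (k.+1, true) s']
    else false).
  rewrite /ofweight andbAC path_notin; case: s => [|[x b] s] /=; first by rewrite orbF.
  rewrite -!andbA; case: (all (leq 1) _); rewrite ?andbF //= ?andbT.
  have -> c : [&& path follows (x, b) s, (x <= k.+1)%N, all (fun p => p.1 <= k.+1)%N s & c]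
      = [&& path follows (x, b) s, (x <= k.+1)%N & c].
    case: (boolP (path _ _ _)) => //=; rewrite (path_sortedE follows_trans) => /andP[/allP h _].
    case: leqP => //= lex; rewrite (_ : all _ s) //; apply/allP => -[y d] /h.
    by rewrite /follows /=; case: d; lia.
  rewrite /follows /=; case: b => /=.
    case: (eqVneq x k.+1) => [->|nx] /=; last first.
      by rewrite orbF; case: (path _ _ _); rewrite ?andbF //=; lia.
    by rewrite ltnn leqnn /=; case: (path _ _ _); rewrite ?andbF //=; lia.
  by rewrite andbF orbF; case: (path _ _ _); rewrite ?andbF //=; lia.
case: ltnP => ltnk.
  exists e0; split; last by rewrite addr0.
  split=> // s; rewrite E0 E; case: s => [|p s]; rewrite ?orbF // [X in _ || (_ && X)]/=.
  by rewrite leqNgt ltnk andbF orbF.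
have [e1 [[U1 E1] S1]] := F (n - k.+1)%N.
exists (e0 ++ map (cons (k.+1, true)) e1); split; last first.
  by rewrite size_cat size_map natrD S1 S0.
split.
  rewrite cat_uniq U0 map_inj_uniq ?U1 ?andbT /=; last by move=> ? ? [].
  apply/hasPn => s /mapP[s' _ ->]; rewrite /= E0 /ofweight /=.
  by rewrite /follows /= ltnn.
move=> s; rewrite mem_cat E0 E; congr (_ || _).
apply/mapP/idP => [[s' s'in ->]|].
  by rewrite eqxx ltnk -E1.
case: s => // p s /and3P[/eqP -> _ w]; exists s => //; by rewrite E1.
Qed.

(** The parts of an overpartition of [n] are at most [n], so the bound [N] excludes none. *)
Lemma num_overpartitions_opgf N n :
  (n <= N)%N -> (num_overpartitions n)%:R = opgf N n.
Proof.
move=> lenN; have [e [[U E] <-]] := opgf_enum N n; congr (_%:R).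
apply: num_overpartitionsE => // s; rewrite E /ofweight andbAC path_notin -andbA.
rewrite is_overpartitionE; congr (_ && _); rewrite andb_idl // => ws.
case/andP: ws => _ /eqP <- {E} in lenN *; elim: s lenN => //= -[x b] s IH /= h.
by rewrite IH ?andbT; lia.
Qed.


(** * Gauss's identity, through a finite form *)

Definition msign (k : nat) : fps R := (-1) ^+ k * (if k == 0%N then 1 else 2%:R).

(** The q-Pochhammer symbol [(q)_k] is [poch k], and [ipoch k] is its inverse. *)
Fixpoint ipoch (k : nat) : fps R := if k is k'.+1 then geo k'.+1 * ipoch k' else 1.
Fixpoint poch (k : nat) : fps R := if k is k'.+1 then (1 - q ^+ k'.+1) * poch k' else 1.

Lemma pochK k : poch k * ipoch k = 1.
Proof.
elim: k => [|k IH] /=; first by rewrite mulr1.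
by rewrite mulrACA geoE // IH mulr1.
Qed.
Lemma ipochE k : (1 - q ^+ k.+1) * ipoch k.+1 = ipoch k.
Proof. by rewrite /= mulrA geoE // mul1r. Qed.

Lemma opgfS k : opgf k.+1 = (1 + q ^+ k.+1) * (geo k.+1 * opgf k). Proof. by []. Qed.
Lemma pochS k : poch k.+1 = (1 - q ^+ k.+1) * poch k. Proof. by []. Qed.
Lemma ipochS k : ipoch k.+1 = geo k.+1 * ipoch k. Proof. by []. Qed.
Lemma ipoch0 : ipoch 0 = 1. Proof. by []. Qed.
Arguments ipoch : simpl never.
Arguments poch : simpl never.

(* The sum over all integers [k] of [(-1)^k q^(k^2) / ((q)_(N-k) (q)_(N+k))], the
   terms of index [k] and [- k] being grouped. *)
Definition gauss_sum (N : nat) : fps R :=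
  \sum_(k < N.+1) msign k * q ^+ (k ^ 2) * ipoch (N - k) * ipoch (N + k).

(** Certificate for creative telescoping; it is 0 from [k = N] on, so that the telescoped sum
    vanishes. *)
Definition gauss_cert (N k : nat) : fps R :=
  if (k < N)%N then 2%:R * (-1) ^+ k * q ^+ (k ^ 2 + k + N) * ipoch (N - k.+1) * ipoch (N + k)
  else 0.

(** Term by term the two sides differ by [gauss_cert N.+1 k - gauss_cert N.+1 (k - 1)], the
    subtracted term being 0 at [k = 0]; these differences telescope to 0. *)
Lemma gauss_sumS N : (1 - q ^+ (N.+1 * 2)) * gauss_sum N.+1 = gauss_sum N.
Proof.
have tele k : (k <= N.+1)%N ->
  (1 - q ^+ (N.+1 * 2)) * (msign k * q ^+ (k ^ 2) * ipoch (N.+1 - k) * ipoch (N.+1 + k))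
  = (if (k <= N)%N then msign k * q ^+ (k ^ 2) * ipoch (N - k) * ipoch (N + k) else 0)
    + (gauss_cert N.+1 k - if k is k'.+1 then gauss_cert N.+1 k' else 0).
  (* The top index [N.+1] has no counterpart in [gauss_sum N]. *)
  rewrite leq_eqVlt => /orP[/eqP ->|ltkN].
    rewrite ltnn add0r subnn /gauss_cert ltnn ltnSn subnn sub0r /msign ipoch0 /= mulr1 mulr1.
    have -> : (N.+1 * 2 = (N.+1 + N).+1)%N by lia.
    rewrite -(ipochE (N.+1 + N)) addnS exprS.
    have -> : (N.+1 ^ 2 = N ^ 2 + N + N.+1)%N by rewrite -!mulnn; lia.
    by rewrite [(-1) ^+ N.+1]exprS; set e := (-1) ^+ N; set u := _ ^+ (N.+1 + N); ring.
  have lekN : (k <= N)%N by [].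
  (* With [N = k + j] no truncated subtraction remains, and all powers of [q] become products that
     [ring] can handle. *)
  have [j EN] : exists j, N = (k + j)%N by exists (N - k)%N; rewrite subnKC.
  rewrite lekN /gauss_cert ltkN subSS EN addKn.
  have -> : ((k + j).+1 - k = j.+1)%N by lia.
  rewrite -(ipochE j) [ipoch (k + j + k)](_ : _ = (1 - q ^+ (k + j + k).+1) * ipoch ((k + j).+1 + k));
    last by rewrite -ipochE.
  set X := ipoch j.+1; set Y := ipoch (_ + k).
  have -> : q ^+ (k ^ 2 + k + (k + j).+1) = q ^+ (k ^ 2) * q ^+ k * q ^+ k * q ^+ j.+1.
    by rewrite -!exprD; congr (_ ^+ _); lia.
  have -> : q ^+ ((k + j).+1 * 2) = q ^+ k * q ^+ k * q ^+ j.+1 * q ^+ j.+1.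
    by rewrite -!exprD; congr (_ ^+ _); lia.
  have -> : q ^+ (k + j + k).+1 = q ^+ k * q ^+ k * q ^+ j.+1.
    by rewrite -!exprD; congr (_ ^+ _); lia.
  case: k ltkN lekN EN @Y => [|k] ltkN lekN EN Y.
    by rewrite /msign /= !expr0; ring.
  have -> : (k < (k.+1 + j).+1)%N by lia.
  have -> : ((k.+1 + j).+1 - k.+1 = j.+1)%N by lia.
  have -> : q ^+ (k ^ 2 + k + (k.+1 + j).+1) = q ^+ (k.+1 ^ 2) * q ^+ j.+1.
    by rewrite -!exprD; congr (_ ^+ _); rewrite -!mulnn; lia.
  have -> : ipoch ((k.+1 + j).+1 + k) =
     (1 - q ^+ k.+1 * q ^+ k.+1 * q ^+ j.+1) * ipoch ((k.+1 + j).+1 + k.+1).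
    rewrite addnS -ipochE -!exprD; congr ((1 - _ ^+ _) * _); lia.
  rewrite -/X -/Y /msign /= [(-1) ^+ k.+1]exprS; set e := (-1) ^+ k.
  by set u := q ^+ k.+1; set v := q ^+ (k.+1 ^ 2); set t := q ^+ j.+1; ring.
rewrite /gauss_sum mulr_sumr (eq_bigr _ (fun (k : 'I_N.+2) _ => tele k (ltn_ord k))) big_split /=.
rewrite [X in _ + X](_ : _ = 0) ?addr0.
  rewrite big_ord_recr /= ltnn addr0; apply: eq_bigr => i _.
  by rewrite -ltnS ltn_ord.
rewrite -(big_mkord xpredT (fun k => gauss_cert N.+1 k - match k with 0%N => 0 | k'.+1 => gauss_cert N.+1 k' end)).
have -> : forall M, \sum_(0 <= k < M.+1) (gauss_cert N.+1 k - match k with 0%N => 0 | k'.+1 => gauss_cert N.+1 k' end) = gauss_cert N.+1 M.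
  by elim=> [|M IHM]; rewrite ?big_nat1 ?subr0 // big_nat_recr //= IHM; ring.
by rewrite /gauss_cert ltnn.
Qed.

(** With [x = q ^ N.+1], the step multiplies [opgf] by [(1 + x) / (1 - x)] and [poch ^ 2] by
    [(1 - x) ^ 2]; the product [1 - x ^ 2] is absorbed by the recurrence of [gauss_sum]. *)
Lemma opgf_gauss N : opgf N * (poch N ^+ 2 * gauss_sum N) = 1.
Proof.
elim: N => [|N IH].
  have -> : opgf 0 = 1 by [].
  have -> : poch 0 = 1 by [].
  by rewrite /gauss_sum big_ord1 /msign !ipoch0 /= !expr1n !expr0 !mulr1.
rewrite -[RHS]IH -[gauss_sum N]gauss_sumS opgfS pochS exprM.
have := @geoE N.+1 isT; set x := q ^+ N.+1; set g := geo _ => E.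
rewrite -[RHS]mul1r -[X in _ = X * _]E; ring.
Qed.

(** The error is kept as a factor, so that it is still controlled after multiplication by
    [ipoch a]. *)
Lemma poch_near a b : (a <= b)%N -> exists g, poch b = poch a * (1 + q ^+ a.+1 * g).
Proof.
move=> /subnKC <-; elim: (b - a)%N => [|d [g IH]].
  by exists 0; rewrite addn0 mulr0 addr0 mulr1.
exists (g - q ^+ d * (1 + q ^+ a.+1 * g)).
rewrite addnS pochS IH -addSn exprD; ring.
Qed.

Lemma ipoch_near a b : (a <= b)%N -> exists g, ipoch b = ipoch a * (1 + q ^+ a.+1 * g).
Proof.
move=> /subnKC <-; elim: (b - a)%N => [|d [g IH]].
  by exists 0; rewrite addn0 mulr0 addr0 mulr1.
have Eg : geo (a + d).+1 = 1 + q ^+ (a + d).+1 * geo (a + d).+1.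
  by rewrite -{1}(@geoE (a + d).+1) //; ring.
exists (g + q ^+ d * geo (a + d).+1 * (1 + q ^+ a.+1 * g)).
rewrite addnS ipochS IH {1}Eg -addSn exprD; ring.
Qed.

(** The ratio of [(q)_N ^ 2] to [(q)_(N-k) (q)_(N+k)] is 1 up to order [N - k + 1], and the factor
    [q ^ (k ^ 2)] pushes this error beyond [q ^ N] because [k <= k ^ 2]. *)
Lemma gauss_sum_limit N :
  feqm N (poch N ^+ 2 * gauss_sum N) (\sum_(k < N.+1) msign k * q ^+ (k ^ 2)).
Proof.
move=> n lenN; rewrite /gauss_sum mulr_sumr !fcoef_sum; apply: eq_bigr => k _.
have lekN : (k <= N)%N by rewrite -ltnS.
have [g Eg] := poch_near (leq_subr k N); have [h Eh] := ipoch_near (leq_addr k N).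
set t := _ * q ^+ _.
have -> : poch N ^+ 2 * (t * ipoch (N - k) * ipoch (N + k)) =
   t * (poch N * ipoch (N - k)) * (poch N * ipoch (N + k)) by ring.
rewrite {1}Eg Eh [poch N * (_ * _)]mulrA [poch (N - k) * _ * _]mulrAC !pochK !mul1r.
have -> : t * (1 + q ^+ (N - k).+1 * g) * (1 + q ^+ N.+1 * h) =
  t + q ^+ (k ^ 2 + (N - k).+1) * (msign k * g) + q ^+ N.+1 * (t * (1 + q ^+ (N - k).+1 * g) * h).
  by rewrite /t exprD; ring.
rewrite 2!fcoefD !fcoefXnM ltnS lenN addr0.
have -> : (n < k ^ 2 + (N - k).+1)%N by rewrite -mulnn; have := leq_sqr 1 k; nia.
by rewrite addr0.
Qed.

Definition Pgf : fps R := Fps (fun n => (num_overpartitions n)%:R).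

Lemma Pgf_inv (th : fps R) :
  (forall N, feqm N (\sum_(k < N.+1) msign k * q ^+ (k ^ 2)) th) -> Pgf * th = 1.
Proof.
move=> H; apply: fpsP => n; rewrite -(opgf_gauss n).
apply: (@feqmM _ n) => // i lein; first by rewrite -(num_overpartitions_opgf lein).
by rewrite gauss_sum_limit // H.
Qed.

End Count.

(** * Theta series *)

(** The integers from [- N] to [N], listed so that grouping [k] with [- k] amounts to splitting the
    list. *)
Definition box (N : nat) : seq int :=
  0 :: [seq k.+1%:Z | k <- iota 0 N] ++ [seq - k.+1%:Z | k <- iota 0 N].

Arguments box : simpl never.

Lemma mem_box N x : (x \in box N) = (`|x| <= N)%N.
Proof.
rewrite /box in_cons mem_cat; apply/idP/idP => [/or3P[/eqP -> //|/mapP[k]|/mapP[k]]|].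
- by rewrite mem_iota => ? ->; lia.
- by rewrite mem_iota => ? ->; lia.
case: x => [[|k]|k] //= lek; first by rewrite map_f ?mem_iota //= orbT.
by rewrite NegzE (map_f (fun k => - k.+1%:Z)) ?orbT // mem_iota.
Qed.

Lemma box_uniq N : uniq (box N).
Proof.
rewrite /box /= mem_cat cat_uniq !map_inj_uniq ?iota_uniq /= ?andbT; last 2 first.
- by move=> i j; lia.
- by move=> i j; lia.
apply/andP; split; first by apply/norP; split; apply/mapP => -[k _]; lia.
by apply/hasPn => y /mapP[k _ ->]; apply/mapP => -[j _]; lia.
Qed.

(** All representations of [n] as a sum of two squares: the box is large enough since an integer is
    bounded by its square. *)
Definition sq2 (n : nat) : seq (int * int) :=
  [seq p <- [seq (x, y) | x <- box n, y <- box n] | (`|p.1| ^ 2 + `|p.2| ^ 2 == n)%N].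

Lemma mem_sq2 n p : (p \in sq2 n) = (`|p.1| ^ 2 + `|p.2| ^ 2 == n)%N.
Proof.
rewrite mem_filter andb_idr // => /eqP E; case: p E => x y E.
by apply: (allpairs_f pair); rewrite mem_box; move: E => /= E; nia.
Qed.

Lemma sq2_uniq n : uniq (sq2 n).
Proof.
by rewrite filter_uniq // allpairs_uniq ?box_uniq // => -[? ?] [? ?] _ _ [-> ->].
Qed.

(** The squares of [a + b] and [a - b] add up to twice [a ^ 2 + b ^ 2]; conversely, two integers
    whose squares have an even sum have the same parity, so the map can be inverted. *)
Lemma sq2_double n :
  perm_eq [seq (p.1 + p.2, p.1 - p.2) | p <- sq2 n] (sq2 n.*2).
Proof.
apply: uniq_perm; rewrite ?sq2_uniq // ?map_inj_uniq ?sq2_uniq //.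
  by move=> [a b] [c d] /= [h1 h2]; congr (_, _); lia.
move=> [x y]; rewrite mem_sq2 /=; apply/mapP/eqP => [[[a b]]|E].
  by rewrite mem_sq2 /= => /eqP E [-> ->]; nia.
have [a Ea] : exists a : int, x + y = a * 2.
  exists ((x + y) %/ 2)%Z; nia.
exists (a, x - a); last by congr (_, _) => /=; lia.
rewrite mem_sq2 /=; apply/eqP.
have Ey : y = a * 2 - x by lia.
subst y; nia.
Qed.

Lemma sq2_swap n : perm_eq [seq (p.2, p.1) | p <- sq2 n] (sq2 n).
Proof.
apply: uniq_perm; rewrite ?sq2_uniq // ?map_inj_uniq ?sq2_uniq //.
  by move=> [a b] [c d] /= [-> ->].
move=> [x y]; rewrite mem_sq2 /=; apply/mapP/eqP => [[[a b]]|E].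
  by rewrite mem_sq2 /= => /eqP E [-> ->]; rewrite addnC.
by exists (y, x); rewrite // mem_sq2 /= addnC E.
Qed.

Section Theta.
Variable R : comNzRingType.
Local Notation q := (fvar R).

(** The sum of [s ^ |x| q ^ (x ^ 2)] over all integers: [theta (-1)] is the series of Gauss's
    identity and [theta 1] its value at [- q]. *)
Definition theta (s : R) : fps R :=
  Fps (fun n => \sum_(x <- box n | (`|x| ^ 2 == n)%N) s ^+ `|x|).

Lemma theta_box s N n : (n <= N)%N ->
  theta s n = \sum_(x <- box N | (`|x| ^ 2 == n)%N) s ^+ `|x|.
Proof.
move=> lenN; rewrite /= -big_filter -[RHS]big_filter; apply: perm_big.
apply: uniq_perm; rewrite ?filter_uniq ?box_uniq // => x.
rewrite !mem_filter !mem_box; case: eqP => //= E; nia.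
Qed.

Lemma thetaM s t n :
  (theta s * theta t) n = \sum_(p <- sq2 n) s ^+ `|p.1| * t ^+ `|p.2|.
Proof.
rewrite fcoefM [RHS]big_filter [RHS]big_mkcond big_allpairs.
rewrite (eq_bigr (fun i : 'I_n.+1 => \sum_(x <- box n) \sum_(y <- box n)
   if ((`|x| ^ 2 == i) && (`|y| ^ 2 == n - i))%N then s ^+ `|x| * t ^+ `|y| else 0)).
  rewrite exchange_big; apply: eq_bigr => x _; rewrite exchange_big.
  apply: eq_bigr => y _ /=; case: ifP => [/eqP E|nE].
    have ltx : (`|x| ^ 2 < n.+1)%N by lia.
    rewrite (bigD1 (Ordinal ltx)) //= eqxx big1 => [|i].
      by rewrite addr0 -E addKn eqxx.
    by rewrite -val_eqE /= eq_sym => /negPf ->.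
  apply: big1 => i _; case: ifP => // /andP[/eqP E1 /eqP E2].
  by move: nE; have := ltn_ord i; lia.
move=> i _; have lein : (i <= n)%N by rewrite -ltnS.
rewrite (theta_box s lein) (theta_box t (leq_subr i n)) mulr_suml [LHS]big_mkcond.
apply: eq_bigr => x _; rewrite mulr_sumr; case: ifP => _; last first.
  by rewrite big1.
by rewrite big_mkcond.
Qed.

Lemma theta_gauss N : feqm N (\sum_(k < N.+1) msign R k * q ^+ (k ^ 2)) (theta (-1)).
Proof.
move=> n lenN; rewrite (theta_box _ lenN) fcoef_sum.
have E k : (msign R k * q ^+ (k ^ 2)) n =
   if (k ^ 2 == n)%N then (-1) ^+ k * (if k == 0%N then 1 else 2%:R) else 0.
  have -> : msign R k = fconst ((-1) ^+ k * (if k == 0%N then 1 else 2%:R)).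
    by rewrite rmorphM rmorphXn rmorphN1 /msign; case: eqP => _; rewrite ?rmorph1 ?rmorph_nat.
  by rewrite fcoefZ fcoefXn [n == _]eq_sym; case: (_ == n); rewrite ?mulr1 ?mulr0.
rewrite (eq_bigr _ (fun (k : 'I_N.+1) _ => E k)) big_ord_recl expr0 mul1r.
rewrite [RHS]big_mkcond /box big_cons big_cat !big_map expr0; congr (_ + _).
pose F k : R := if (k.+1 ^ 2 == n)%N then (-1) ^+ k.+1 else 0.
rewrite (eq_bigr (fun i : 'I_N => F i + F i)).
  by rewrite big_split -(big_mkord xpredT F) /index_iota subn0.
move=> i _; rewrite lift0 /F; case: eqP => _; last by rewrite addr0.
by rewrite mulr_natr mulr2n.
Qed.

Lemma Pgf_theta : Pgf R * theta (-1) = 1.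
Proof. exact: Pgf_inv theta_gauss. Qed.

Lemma sign_parity n (p : int * int) : p \in sq2 n ->
  (-1) ^+ `|p.1| * (-1) ^+ `|p.2| = (-1) ^+ n :> R.
Proof.
rewrite mem_sq2 => /eqP <-; rewrite -exprD -signr_odd -[RHS]signr_odd.
by rewrite !oddD !oddX.
Qed.

(** A representation of [n] has sign [(-1) ^ n] in the second square, so odd coefficients cancel;
    even ones double and are reindexed by [sq2_double]. *)
Lemma theta_sum : theta 1 ^+ 2 + theta (-1) ^+ 2 = fsub2 (theta 1 ^+ 2) *+ 2.
Proof.
apply: fpsP => n; rewrite mulr2n !fcoefD !expr2 fcoef_sub2 !thetaM -big_split /=.
rewrite (eq_big_seq (fun p => 1 + (-1) ^+ n)); last first.
  by move=> p /sign_parity <-; rewrite !expr1n mulr1.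
case: ifP => oddn.
  by rewrite -signr_odd oddn subrr addr0 big1.
rewrite -signr_odd oddn -big_split /=.
have -> : n = (n./2).*2 by lia.
by rewrite doubleK -(perm_big _ (sq2_double _)) big_map; apply: eq_bigr => p _; rewrite !expr1n mulr1.
Qed.

End Theta.

(** For odd [n], swapping the two squares changes the sign, so the coefficient is its own opposite.
    For even [n], [sq2_double] applies, and [a - b] has the parity of [|a| + |b|]. *)
Lemma theta_prod (K : fieldType) : 2%:R != 0 :> K ->
  theta (1 : K) * theta (-1) = fsub2 (theta (-1) ^+ 2).
Proof.
move=> char2; apply: fpsP => n; rewrite expr2 fcoef_sub2 !thetaM.
case: ifP => oddn.
  set S := LHS; have : S + S = 0.
    rewrite {1}/S -(perm_big _ (sq2_swap _)) big_map /S -big_split /= big_seq big1 // => p.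
    move=> /(@sign_parity K); rewrite -[(-1) ^+ n]signr_odd oddn expr1 !expr1n !mul1r.
    rewrite -(signr_odd _ `|p.1|) -(signr_odd _ `|p.2|).
    case: odd; case: odd; rewrite ?expr0 ?expr1 ?mulr1 ?mulN1r ?opprK ?subrr ?addNr //.
    (* Two entries of equal parity would give [1 = -1]. *)
    - by move=> /eqP; rewrite -subr_eq0 opprK -[1 + 1]/2%:R (negPf char2).
    - by move=> /eqP; rewrite -subr_eq0 opprK -[1 + 1]/2%:R (negPf char2).
  by rewrite -mulr2n -mulr_natr => /eqP; rewrite mulf_eq0 (negPf char2) orbF => /eqP.
have -> : n = (n./2).*2 by lia.
rewrite doubleK -(perm_big _ (sq2_double _)) big_map; apply: eq_bigr => -[a b] _ /=.
rewrite expr1n mul1r -exprD -signr_odd -[RHS]signr_odd; congr (_ ^+ _); congr nat_of_bool.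
lia.
Qed.

(** * The arithmetic-geometric mean *)

Section ThetaODE.
Variable K : fieldType.
Hypothesis char2 : 2%:R != 0 :> K.

Definition thA : fps K := theta 1 ^+ 2.
Definition thB : fps K := theta (-1) ^+ 2.

Lemma thA_sub2 : thA + thB = fsub2 thA *+ 2.
Proof. exact: theta_sum. Qed.

Lemma thB_sub2 : thA * thB = fsub2 thB ^+ 2.
Proof. by rewrite -theta_prod // exprMn. Qed.

Lemma theta_coef0 (s : K) : theta s 0%N = 1.
Proof. by rewrite /= /box big_cons /= big_nil addr0. Qed.

Lemma theta_coef1 (s : K) : theta s 1%N = s *+ 2.
Proof. by rewrite /= /box !big_cons /= big_nil addr0 expr1. Qed.

Lemma thetaX2_coef1 (s : K) : (theta s ^+ 2) 1%N = s *+ 4.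
Proof. by rewrite expr2 fcoefM1 theta_coef0 theta_coef1; ring. Qed.

Definition agm_defect (A B : fps K) : fps K :=
  2%:R * (fD A * B - A * fD B) - A * B * (A ^+ 2 - B ^+ 2).

(* [A(q^2)] and [B(q^2)] are the arithmetic and geometric means of [A], [B]. *)
Lemma agm_defect_sub2 (A B : fps K) :
  A + B = fsub2 A *+ 2 -> A * B = fsub2 B ^+ 2 ->
  8%:R * (fsub2 B * fsub2 (agm_defect A B)) = (A - B) * agm_defect A B.
Proof.
move=> HA HB.
have DA : fD A + fD B = fsub2 (fD A) *+ 4.
  by rewrite -raddfD HA raddfMn /= fD_sub2 -mulrnA.
have DB : fD A * B + A * fD B = fsub2 (fD B) * fsub2 B *+ 4.
  by rewrite -fDM HB expr2 fDM fD_sub2; ring.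
rewrite /agm_defect !(rmorphB, rmorphM, rmorphXn, rmorph_nat).
set A2 := fsub2 A in HA *; set B2 := fsub2 B in HB DB *.
set a := fsub2 (fD A) in DA *; set b := fsub2 (fD B) in DB *.
transitivity (4%:R * (a *+ 4) * B2 ^+ 2 - 2%:R * (A2 *+ 2) * (b * B2 *+ 4)
   - (A2 *+ 2) * B2 ^+ 2 * ((A2 *+ 2) ^+ 2 - 4%:R * B2 ^+ 2)); first by ring.
by rewrite -HA -HB -DA -DB; ring.
Qed.

(** As [A - B] starts with [8 q], a defect of order [n >= 2] would have order [n + 1] on one side of
    [agm_defect_sub2] and at least [2 n] on the other. The coefficients 0 and 1 are computed. *)
Lemma theta_ode : 2%:R * (fD thA * thB - thA * fD thB) = thA * thB * (thA ^+ 2 - thB ^+ 2).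
Proof.
apply/eqP; rewrite -subr_eq0; apply/eqP; set X : fps K := LHS.
have EX := agm_defect_sub2 thA_sub2 thB_sub2; rewrite -[agm_defect _ _]/X in EX.
apply: fpsP.
have a0 : thA 0%N = 1 by rewrite fcoefXn0 theta_coef0 expr1n.
have b0 : thB 0%N = 1 by rewrite fcoefXn0 theta_coef0 expr1n.
have a1 : thA 1%N = 4%:R by rewrite thetaX2_coef1.
have b1 : thB 1%N = - 4%:R by rewrite thetaX2_coef1 mulNrn.
have X0 : X 0%N = 0.
  rewrite /X fcoefB -[2%:R](rmorph_nat (@fconst K)) fcoefZ fcoefB !fcoefM0 fcoefB 2!fcoefXn0.
  by rewrite !fcoef_fD a0 b0; ring.
have X1 : X 1%N = 0.
  rewrite /X fcoefB -[2%:R](rmorph_nat (@fconst K)) fcoefZ fcoefB !(expr2, fcoefM1, fcoefM0, fcoefB).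
  by rewrite !fcoef_fD a0 b0 a1 b1 !theta_coef0 !theta_coef1; ring.
elim/ltn_ind => -[|[|n]] IH; rewrite fcoef0 // in IH *.
have char8 : 8%:R != 0 :> K.
  by rewrite (_ : 8%N = 2 * 2 * 2)%N // !natrM !mulf_neq0.
(* At index [n.+3] the left side involves the defect only up to half that index, where it is known
   to vanish, and the right side is 8 times its coefficient at [n.+2]. *)
have /(congr1 (fun f : fps K => f n.+3)) := EX.
rewrite -[8%:R](rmorph_nat (@fconst K)) fcoefZ !fcoefM.
rewrite [X in 8%:R * X]big1 ?mulr0; last first.
  move=> i _; rewrite [fsub2 X _]fcoef_sub2; case: ifP => od; rewrite ?mulr0 //.
  by rewrite IH ?fcoef0 ?mulr0 //; lia.
rewrite big_ord_recl big_ord_recl big1 ?addr0; last first.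
  move=> i _; rewrite IH ?fcoef0 ?mulr0 //= /bump /=; lia.
rewrite subn0 fcoefB a0 b0 subrr mul0r add0r fcoefB lift0 a1 b1 subSS subn0.
by rewrite opprK -natrD => /esym/eqP; rewrite mulf_eq0 (negPf char8) => /eqP.
Qed.
End ThetaODE.

(** * Two expansions of the homogeneous Hasse polynomial *)

Section Hasse.
Variable R : comNzRingType.

Definition hasse (m : nat) (a b : R) : R :=
  \sum_(j < m.+1) ('C(m, j) ^ 2)%:R * a ^+ (2 * j) * b ^+ (2 * (m - j)).

Lemma hasseC m a b : hasse m a b = hasse m b a.
Proof.
rewrite /hasse (reindex_inj rev_ord_inj); apply: eq_bigr => j _ /=.
have lejm : (j <= m)%N by rewrite -ltnS.
by rewrite subSS subKn // bin_sub // mulrAC.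
Qed.

(** Both sides are the coefficient of [X ^ m] in the [m]-th power of [(b + a X) (b X + a) = (a + b)
    ^ 2 X + a b (X - 1) ^ 2]. *)
Lemma hasse_central m a b :
  hasse m a b = \sum_(j < m.+1) 'C(m, j)%:R * ((-1) ^+ j * 'C(2 * j, j)%:R) *
     (a + b) ^+ (2 * (m - j)) * (a * b) ^+ j.
Proof.
have E : (b%:P + a *: 'X) ^+ m * (b *: 'X + a%:P) ^+ m =
   (((a + b) ^+ 2) *: 'X + (a * b) *: ('X - 1) ^+ 2) ^+ m :> {poly R}.
  by rewrite -exprMn; congr (_ ^+ _); rewrite -!mul_polyC !(rmorphD, rmorphM, rmorphXn) /=; ring.
have coefL (u v : R) n j : ((u%:P + v *: 'X : {poly R}) ^+ n)`_j =
    if (j <= n)%N then 'C(n, j)%:R * u ^+ (n - j) * v ^+ j else 0.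
  rewrite exprDn coef_sum.
  have cf i : ((u%:P ^+ (n - i) * (v *: 'X) ^+ i) *+ 'C(n, i))`_j =
     ('C(n, i)%:R * u ^+ (n - i) * v ^+ i) * (j == i)%:R.
    by rewrite coefMn exprZn -polyC_exp mul_polyC !coefZ coefXn -[LHS]mulr_natl !mulrA.
  rewrite (eq_bigr _ (fun (i : 'I_n.+1) _ => cf i)); case: leqP => [lejn|ltnj].
    rewrite (bigD1 (Ordinal (lejn : (j < n.+1)%N))) //= eqxx mulr1 big1 ?addr0 // => i.
    by rewrite -val_eqE /= eq_sym => /negPf ->; rewrite mulr0.
  by rewrite big1 // => i _; rewrite gtn_eqF ?mulr0 // (leq_trans _ ltnj).
have -> : hasse m a b = ((b%:P + a *: 'X) ^+ m * (b *: 'X + a%:P) ^+ m : {poly R})`_m.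
  rewrite coefM; apply: eq_bigr => j _.
  have lejm : (j <= m)%N by rewrite -ltnS.
  rewrite [b *: 'X + _]addrC !coefL lejm leq_subr subKn // bin_sub //.
  by rewrite !(mulnC 2%N) !exprM -mulnn natrM; ring.
rewrite E exprDn coef_sum; apply: eq_bigr => j _.
have lejm : (j <= m)%N by rewrite -ltnS.
rewrite coefMn !exprZn -scalerAl -scalerAr !coefZ -!exprM coefXnM ltnNge leq_subr /=.
have -> : (('X - 1) ^+ (2 * j) : {poly R})`_(m - (m - j)) = (-1) ^+ j * 'C(2 * j, j)%:R.
  have -> : 'X - 1 = (-1)%:P + 1 *: 'X :> {poly R} by rewrite scale1r addrC rmorphN1.
  rewrite coefL subKn // (_ : (j <= 2 * j)%N) ?expr1n ?mulr1; last by lia.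
  by rewrite mulrC; congr (_ ^+ _ * _); lia.
by rewrite -[LHS]mulr_natl; ring.
Qed.
End Hasse.

(** * The Hasse polynomial *)

Section CharL.
Variables (K : fieldType) (m : nat).
Hypothesis m_gt0 : (0 < m)%N.
Hypothesis pcharK : (2 * m).+1 \in [pchar K].

Lemma natr_lt_neq0 n : (0 < n < (2 * m).+1)%N -> n%:R != 0 :> K.
Proof. by case/andP=> n_gt0 ltn; rewrite -(dvdn_pcharf pcharK) gtnNdvd. Qed.

Lemma two_neq0 : 2%:R != 0 :> K.
Proof. by apply: natr_lt_neq0; lia. Qed.

Lemma two_m : 2%:R * m%:R = -1 :> K.
Proof. by apply/eqP; rewrite -subr_eq0 opprK -natrM natr1 (pcharf0 pcharK). Qed.

Lemma natf_expl n : n%:R ^+ (2 * m).+1 = n%:R :> K.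
Proof. by have := pFrobenius_aut_nat pcharK n; rewrite pFrobenius_autE. Qed.

Lemma natf_exp2m n : n%:R != 0 :> K -> n%:R ^+ (2 * m) = 1 :> K.
Proof. by move=> nz; apply: (mulfI nz); rewrite -exprS natf_expl mulr1. Qed.

Lemma fact_neq0 n : (n < (2 * m).+1)%N -> n`!%:R != 0 :> K.
Proof.
elim: n => [|n IH] ltn; first by rewrite fact0 oner_neq0.
by rewrite factS natrM; apply: mulf_neq0; [apply: natr_lt_neq0; lia | apply: IH; lia].
Qed.

(* [m] is [-1/2] in [K]. *)
Lemma central_bin j : (j <= m)%N ->
  (-1) ^+ j * 'C(2 * j, j)%:R = 4%:R ^+ j * 'C(m, j)%:R :> K.
Proof.
elim: j => [|j IH] ltj; first by rewrite !expr0 !bin0.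
have /mulfI : j.+1%:R != 0 :> K by apply: natr_lt_neq0; lia.
apply.
have E1 : j.+1%:R * 'C(2 * j.+1, j.+1)%:R = 2%:R * (2 * j).+1%:R * 'C(2 * j, j)%:R :> K.
  rewrite -!natrM; congr _%:R; apply/eqP; rewrite -(eqn_pmul2l (ltn0Sn j)); apply/eqP.
  have h1 := mul_bin_diag (2 * j.+1) j.
  have h2 := mul_bin_diag (2 * j).+1 j; have h3 := mul_bin_left (2 * j).+1 j.
  have e : (2 * j.+1 = (2 * j).+2)%N by lia.
  rewrite e /= in h1 h2 h3 *; nia.
have E2 : j.+1%:R * 'C(m, j.+1)%:R = (m%:R - j%:R) * 'C(m, j)%:R :> K.
  by rewrite -natrM mul_bin_left natrM natrB // ltnW.
rewrite mulrCA E1 [RHS]mulrCA E2.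
transitivity (- (2%:R * (2 * j).+1%:R) * ((-1) ^+ j * 'C(2 * j, j)%:R) : K).
  by rewrite exprS; ring.
rewrite IH; last exact: ltnW.
(* Since [2 m = -1], the factor [- (2 j + 1)] equals [2 m - 2 j]. *)
transitivity (4%:R ^+ j * 2%:R * (2%:R * m%:R - 2%:R * j%:R) * 'C(m, j)%:R : K).
  by rewrite two_m -[(2 * j).+1%:R]natr1 natrM; ring.
by rewrite exprS; ring.
Qed.

(** In [hasse_central] the sum and product of [a] and [b] become [2 a2] and [b2 ^ 2]; by
    [central_bin] every term then carries the power [2 ^ (2 m)], which is 1 by Fermat. *)
Lemma hasse_agm (a b a2 b2 : fps K) :
  a + b = a2 *+ 2 -> a * b = b2 ^+ 2 -> hasse m a b = hasse m a2 b2.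
Proof.
move=> Ha Hb; rewrite hasse_central hasseC Ha Hb; apply: eq_bigr => j _.
have lejm : (j <= m)%N by rewrite -ltnS.
have -> : (-1) ^+ j * 'C(2 * j, j)%:R = 4%:R ^+ j * 'C(m, j)%:R :> fps K.
  have /(congr1 (@fconst K)) := central_bin lejm.
  by rewrite !(rmorphM, rmorphXn, rmorphN1, rmorph_nat).
have E : 2%:R ^+ (2 * j) * 2%:R ^+ (2 * (m - j)) = 1 :> fps K.
  rewrite -exprD -mulnDr subnKC // -(rmorph_nat (@fconst K)) -rmorphXn.
  by rewrite natf_exp2m ?rmorph1 // two_neq0.
have -> : 4%:R ^+ j = 2%:R ^+ (2 * j) :> fps K.
  by rewrite exprM; congr (_ ^+ _); ring.
have -> : (a2 *+ 2) ^+ (2 * (m - j)) = 2%:R ^+ (2 * (m - j)) * a2 ^+ (2 * (m - j)).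
  by rewrite -exprMn mulr_natl.
rewrite -exprM -mulnn natrM.
transitivity (2%:R ^+ (2 * j) * 2%:R ^+ (2 * (m - j)) *
  ('C(m, j)%:R * 'C(m, j)%:R * b2 ^+ (2 * j) * a2 ^+ (2 * (m - j)))).
  by set u := 2%:R ^+ (2 * j); set v := 2%:R ^+ _; ring.
by rewrite E mul1r.
Qed.

Definition hpoly : {poly K} := \poly_(j < m.+1) ('C(m, j) ^ 2)%:R.
Definition hconst : K := hpoly.[1].

(** By [hasse_agm] the series is unchanged when [q] becomes [q ^ 2], hence constant; both theta
    series have constant term 1. *)
Lemma hasse_theta : hasse m (thA K) (thB K) = fconst hconst.
Proof.
rewrite (fsub2_fixed (f := hasse m (thA K) (thB K))).
  congr fconst; rewrite /hconst horner_poly fcoef_sum; apply: eq_bigr => j _.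
  rewrite -(rmorph_nat (@fconst K)) -mulrA fcoefZ fcoefM0 !fcoefXn0 expr1n mulr1.
  by rewrite !theta_coef0 !expr1n !mulr1.
rewrite {1}(hasse_agm (thA_sub2 K) (thB_sub2 two_neq0)) /hasse rmorph_sum.
by apply: eq_bigr => j _; rewrite !(rmorphM, rmorphXn, rmorph_nat).
Qed.

(** By Vandermonde the constant is the central binomial coefficient of [2 m], a divisor of [(2 m)!],
    which is prime to the characteristic. *)
Lemma hconst_neq0 : hconst != 0.
Proof.
have -> : hconst = 'C(m + m, m)%:R.
  rewrite /hconst horner_poly -binomial.Vandermonde natr_sum; apply: eq_bigr => j _.
  by rewrite expr1n mulr1 -mulnn bin_sub // -ltnS.
have /(congr1 (fun n : nat => n%:R : K)) := bin_fact (leq_addr m m).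
have : (m + m)`!%:R != 0 :> K by apply: fact_neq0; lia.
by move=> h /esym; rewrite natrM; case: eqP => // ->; rewrite mul0r => /eqP; rewrite (negPf h).
Qed.

Lemma coef_hpoly j : hpoly`_j = ('C(m, j) ^ 2)%:R.
Proof. by rewrite coef_poly; case: ltnP => // /bin_small ->. Qed.

Lemma size_hpoly : size hpoly = m.+1.
Proof. by rewrite size_poly_eq // binn oner_neq0. Qed.

(** This hypergeometric equation restates the recursion [(j + 1) ^ 2 c_(j+1) = (m - j) ^ 2 c_j] of
    the squared binomials. *)
Lemma hpoly_ode :
  'X * (1 - 'X) * hpoly^`(2) + (1%:P + (2%:R * m%:R - 1) *: 'X) * hpoly^`() = (m ^ 2)%:R *: hpoly.
Proof.
have bin_rec j : j.+1%:R * 'C(m, j.+1)%:R = (m%:R - j%:R) * 'C(m, j)%:R :> K.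
  rewrite -natrM mul_bin_left natrM; case: (leqP j m) => [lejm|/bin_small ->].
    by rewrite natrB.
  by rewrite !mulr0.
apply/polyP => j; rewrite -[hpoly^`(2)]/(hpoly^`()^`()) -mulrA mulrBl mul1r mulrDl mul1r -scalerAl.
rewrite coefD coefXM coefB coefXM coefD !coefZ coefXM !coef_deriv !coef_hpoly !natrX.
case: j => [|[|j]] /=.
- by have := bin_rec 0%N; rewrite mul1r subr0 bin0 mulr1 => ->; ring.
- have := bin_rec 1%N; have := bin_rec 0%N; rewrite mul1r subr0 bin0 mulr1 => -> E.
  transitivity ((2%:R * 'C(m, 2)%:R) ^+ 2 + (2%:R * m%:R - 1) * m%:R ^+ 2 : K); first by ring.
  by rewrite E; ring.
transitivity ((j.+3%:R * 'C(m, j.+3)%:R) ^+ 2 + 'C(m, j.+2)%:R ^+ 2 *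
  ((2%:R * m%:R - 1) * j.+2%:R - j.+2%:R * j.+1%:R) : K); first by ring.
by rewrite bin_rec; ring.
Qed.

(** Differentiation keeps the shape of the equation and its leading coefficient [X (1 - X)]; the
    values of the constants do not matter. *)
Lemma hpoly_ode_deriv k : exists a b c : K,
  'X * (1 - 'X) * hpoly^`(k.+2) + (a%:P + b *: 'X) * hpoly^`(k.+1) = c *: hpoly^`(k).
Proof.
elim: k => [|k [a [b [c IH]]]]; first by eexists _, _, _; exact: hpoly_ode.
exists (a + 1), (b - 2%:R), (c - b).
have := congr1 (@deriv K) IH.
rewrite !(derivD, derivM, derivZ, derivC, derivX, derivN) -!derivnS => E.
rewrite [RHS]scalerBl -E -!mul_polyC !(polyCD, polyCN) /=; ring.
Qed.

(** At a double root other than 0 and 1 the differentiated equations make all derivatives vanish,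
    but the [m]-th one is [m!]. *)
Lemma hpoly_simple x : root hpoly x -> x != 0 -> x != 1 -> hpoly^`().[x] != 0.
Proof.
move=> /rootP r0 x0 x1; apply/eqP => r1.
have V k : hpoly^`(k).[x] = 0 /\ hpoly^`(k.+1).[x] = 0.
  elim: k => [|k [IH1 IH2]]; first by [].
  split=> //; have [a [b [c /(congr1 (fun p => p.[x]))]]] := hpoly_ode_deriv k.
  rewrite hornerD !hornerM hornerZ IH1 IH2 !mulr0 addr0 !hornerE => /eqP.
  by rewrite !mulf_eq0 (negPf x0) subr_eq0 eq_sym (negPf x1) => /eqP.
have [+ _] := V m.
have -> : hpoly^`(m) = m`!%:R%:P.
  apply/polyP => i; rewrite coef_derivn coefC coef_hpoly.
  case: i => [|i]; first by rewrite addn0 binn ffactnn.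
  by rewrite bin_small ?mul0rn //; lia.
by rewrite hornerC => /eqP; rewrite (negPf (fact_neq0 _)) //; lia.
Qed.

Lemma hpoly_root0 : hpoly.[0] = 1.
Proof. by rewrite horner_coef0 coef_hpoly bin0. Qed.

End CharL.

(** * Freeness of the powers of an Eisenstein element *)

Section Eisenstein.
Variables (K : fieldType) (S : comNzRingType) (phi : {rmorphism {poly K} -> S}).
Variables (m : nat) (w : S) (g h : {poly K}) (x0 : K).
Hypothesis m_gt0 : (0 < m)%N.
Hypothesis wm : w ^+ m = phi g.
Hypothesis gE : g = ('X - x0%:P) * h.
Hypothesis h_x0 : h.[x0] != 0.
Hypothesis phi_reg : forall s, phi ('X - x0%:P) * s = 0 -> s = 0.
Hypothesis phi_inj : forall p, phi p = 0 -> p = 0.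

Let rel (Q : nat -> {poly K}) := \sum_(0 <= i < m) phi (Q i) * w ^+ i.

(** Multiplication by [w ^ r] shifts the coefficients cyclically; those that wrap around acquire the
    factor [w ^ m]. *)
Lemma sum_rotate (F : nat -> S) r : (r <= m)%N ->
  w ^+ r * \sum_(0 <= i < m) F i * w ^+ i =
  \sum_(0 <= k < m) (if (r <= k)%N then F (k - r)%N else w ^+ m * F (k + m - r)%N) * w ^+ k.
Proof.
move=> lerm; rewrite (big_cat_nat (leq0n _) (leq_subr r m)) [RHS](big_cat_nat (leq0n r) lerm).
rewrite mulrDr addrC; congr (_ + _).
  rewrite -[X in _ * \sum_(X <= _ < _) _ = _]add0n (big_addn 0 m (m - r)) subKn // mulr_sumr; apply: eq_big_nat => i /andP[_ lti].
  rewrite leqNgt lti /= -addnBA // -mulrA mulrCA [RHS]mulrCA; congr (_ * _).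
  by rewrite -!exprD; congr (_ ^+ _); lia.
rewrite -[X in _ = \sum_(X <= _ < _) _]add0n (big_addn 0 m r) mulr_sumr; apply: eq_bigr => i _.
by rewrite leq_addl addnK mulrCA -exprD addnC.
Qed.

(* Modulo ['X - x0] the matrix of the multiplication by [rel Q] is triangular with
   diagonal entries [(Q 0).[x0]]. *)
Lemma rel_neq0 Q : (Q 0%N).[x0] != 0 -> rel Q != 0.
Proof.
move=> Q0; apply/eqP => relQ.
(* Column [i] of [N] holds the coefficients of [w ^ i * rel Q]. *)
pose C k i := if (i <= k)%N then Q (k - i)%N else g * Q (k + m - i)%N.
pose N : 'M[{poly K}]_m := \matrix_(k, i) C k i.
pose v : 'rV[S]_m := \row_k w ^+ k.
have vN : v *m map_mx phi N = 0.
  apply/rowP => i; rewrite !mxE.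
  rewrite (eq_bigr (fun k : 'I_m => phi (C k i) * w ^+ k)); last by move=> k _; rewrite !mxE mulrC.
  rewrite -(big_mkord xpredT (fun k => phi (C k i) * w ^+ k)).
  transitivity (w ^+ i * rel Q); last by rewrite relQ mulr0.
  rewrite /rel sum_rotate; last by rewrite ltnW.
  by apply: eq_bigr => k _; rewrite /C; case: ifP => // _; rewrite rmorphM wm.
have : (\det N).[x0] != 0.
  rewrite -[_.[x0]]/(horner_eval x0 (\det N)) -det_map_mx det_trig.
    by apply/prodf_neq0 => i _; rewrite !mxE /horner_eval /C leqnn subnn.
  apply/is_trig_mxP => k i ltki; rewrite !mxE /C leqNgt ltki /=.
  by rewrite /horner_eval hornerM gE hornerM !hornerE subrr !mul0r.
suff -> : \det N = 0 by rewrite horner0 eqxx.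
apply: phi_inj; rewrite -det_map_mx.
(* By the adjugate, the determinant annihilates every [w ^ k], in particular [w ^ 0 = 1]. *)
have := congr1 (mulmx^~ (\adj (map_mx phi N))) vN.
rewrite mul0mx -mulmxA mul_mx_adj mul_mx_scalar => /rowP/(_ (Ordinal m_gt0)).
by rewrite !mxE expr0 mulr1.
Qed.

(** Descent on the degrees. If all coefficients vanish at [x0], the relation is divided by [X - x0];
    otherwise a rotated and divided relation contradicts [rel_neq0]. *)
Lemma rel_free Q : rel Q = 0 -> forall i, (i < m)%N -> Q i = 0.
Proof.
pose d := 'X - x0%:P; move=> relQ.
have [N] : exists N, forall i, (i < m)%N -> (size (Q i) <= N)%N.
  exists (\sum_(i < m) size (Q i))%N => i lti.
  by rewrite (bigD1 (Ordinal lti)) //= leq_addr.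
elim: N Q relQ => [|N IH] Q relQ leN.
  by move=> i /leN; rewrite leqn0 size_poly_eq0 => /eqP.
have [allr|] := boolP (all (fun i => root (Q i) x0) (iota 0 m)).
  have QE i : (i < m)%N -> Q i = d * (Q i %/ d).
    move=> lti; have /allP/(_ i) := allr; rewrite mem_iota => /(_ lti).
    by rewrite mulrC -dvdp_XsubCl => /divpK ->.
  have rel' : rel (fun i => Q i %/ d) = 0.
    apply: phi_reg; rewrite -[RHS]relQ mulr_sumr; apply: eq_big_nat => i /andP[_ lti].
    by rewrite [in RHS]QE // rmorphM mulrA.
  move=> i lti; rewrite QE // (IH _ rel') ?mulr0 // => j /leN.
  by rewrite size_divp ?polyXsubC_eq0 // size_XsubC leq_subLR.
rewrite -has_predC => /hasP[i1]; rewrite mem_iota => /= lti1 nr1.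
have ex : exists i, (i < m)%N && ~~ root (Q i) x0 by exists i1; rewrite lti1.
case: (ex_minnP ex) => i0 /andP[lti0 nr0] mini0.
(* The first coefficient not vanishing at [x0] moves to index 0. Those before it are divisible by
   [d]; the others wrap around and pick up [g = d * h]. *)
pose Q' k := if (m - i0 <= k)%N then Q (k - (m - i0))%N %/ d else h * Q (k + i0)%N.
have : rel Q' != 0.
  by apply: rel_neq0; rewrite /Q' leqn0 subn_eq0 leqNgt lti0 hornerM mulf_neq0.
suff -> : rel Q' = 0 by rewrite eqxx.
apply: phi_reg.
transitivity (w ^+ (m - i0) * rel Q); last by rewrite relQ mulr0.
rewrite /rel sum_rotate ?leq_subr //.
rewrite mulr_sumr; apply: eq_big_nat => k /andP[_ ltk]; rewrite mulrA; congr (_ * _).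
rewrite /Q'; case: leqP => [lek|_]; rewrite -rmorphM.
  congr (phi _); rewrite mulrC divpK // dvdp_XsubCl; apply: contraT => nr.
  by have := mini0 (k - (m - i0))%N; rewrite nr andbT; lia.
have -> : (k + m - (m - i0) = k + i0)%N by lia.
by rewrite mulrA -gE rmorphM wm.
Qed.
End Eisenstein.

(** * Non-vanishing *)

Section Nonvanishing.
Variables (K : fieldType) (m : nat).
Hypothesis m_gt0 : (0 < m)%N.
Hypothesis pcharK : (2 * m).+1 \in [pchar K].

Local Notation th := (theta (-1 : K)).
Local Notation P := (Pgf K).
Local Notation D := (@fD K).
Local Notation G := (hpoly K m).
Local Notation c := (hconst K m).
Local Notation M := (4 * m.+1)%N.

Definition rho : fps K := thA K ^+ 2 * P ^+ 4.

Fact rho_comm : commr_rmorph (@fconst K) rho.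
Proof. by move=> a; apply: mulrC. Qed.

Definition phi : {poly K} -> fps K := horner_morph rho_comm.
HB.instance Definition _ := GRing.RMorphism.on phi.

Lemma phiX : phi 'X = rho. Proof. exact: horner_morphX. Qed.
Lemma phiC a : phi a%:P = fconst a. Proof. exact: horner_morphC. Qed.
Lemma phiZ a p : phi (a *: p) = fconst a * phi p.
Proof. by rewrite -mul_polyC rmorphM /= phiC. Qed.

Lemma P_th k : P ^+ k * th ^+ k = 1.
Proof. by rewrite -exprMn Pgf_theta expr1n. Qed.

Lemma th_inj k (x y : fps K) : x * th ^+ k = y * th ^+ k -> x = y.
Proof.
move=> E; rewrite -[x]mulr1 -[y]mulr1 -(P_th k) !(mulrC (P ^+ k)) !mulrA.
by rewrite E.
Qed.

Lemma rho_thB : rho * th ^+ 4 = thA K ^+ 2.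
Proof. by rewrite -mulrA P_th mulr1. Qed.

Lemma rho_coef0 : rho 0%N = 1.
Proof.
have := congr1 (fun f : fps K => f 0%N) rho_thB.
by rewrite fcoefM0 !fcoefXn0 !theta_coef0 !expr1n mulr1.
Qed.

Lemma rho_coef1 : rho 1%N = 16%:R.
Proof.
have := congr1 (fun f : fps K => f 1%N) rho_thB.
have -> : th ^+ 4 = thB K * thB K by rewrite /thB -exprD.
rewrite fcoefM1 rho_coef0; move: (rho 1%N) => r.
rewrite expr2 !fcoefM1 !fcoefM0 !theta_coef0 !theta_coef1 => E.
apply: (addIr (- 8%:R)).
transitivity (1 * 1 * (1 * 2%:R + 2%:R * 1) + (1 * 2%:R + 2%:R * 1) * (1 * 1) : K).
  by rewrite -E; ring.
by ring.
Qed.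

Lemma phi_MXaddC p a : phi (p * 'X + a%:P) = phi p * rho + fconst a.
Proof. by rewrite rmorphD rmorphM /= phiX phiC. Qed.

Lemma phi_coef0 p : phi p 0%N = p.[1].
Proof.
elim/poly_ind: p => [|p a IH]; first by rewrite rmorph0 fcoef0 horner0.
rewrite phi_MXaddC fcoefD fcoefM0 IH rho_coef0 mulr1.
by rewrite !hornerE.
Qed.

(** Since [rho - 1] starts with [16 q] and 16 is nonzero in [K], a polynomial with a zero of exact
    order [e] at 1 yields a series of exact order [e]. *)
Lemma phi_inj p : phi p = 0 -> p = 0.
Proof.
have [//|nz] := eqVneq p 0.
have [e [q] /implyP/(_ nz) nr ->] := multiplicity_XsubC p 1.
rewrite rmorphM rmorphXn rmorphB /= phiX phiC rmorph1 => /fmul_eq0_unit E.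
have {E} : (rho - 1) ^+ e = 0 by apply: E; rewrite phi_coef0.
pose u := Fps (fun n => rho n.+1); have u0 : u 0%N = 16%:R by exact: rho_coef1.
have -> : rho - 1 = fvar K * u.
  by apply: fpsP => -[|n]; rewrite fcoefXM fcoefB fcoef1 ?rho_coef0 ?subrr ?subr0.
move/(congr1 (fun f : fps K => f e))/eqP.
rewrite exprMn fcoefXnM ltnn subnn fcoefXn0 u0 fcoef0 expf_eq0.
rewrite (_ : 16 = 2 ^ 4)%N // natrX expf_eq0 (negPf (two_neq0 m_gt0 pcharK)).
by rewrite !andbF.
Qed.

Lemma D_phi p : D (phi p) = phi p^`() * D rho.
Proof.
elim/poly_ind: p => [|p a IH]; first by rewrite deriv0 !rmorph0 mul0r raddf0.
rewrite phi_MXaddC raddfD /= fDM fD_const addr0 IH.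
by rewrite derivD derivM derivC derivX addr0 mulr1 rmorphD rmorphM /= phiX; ring.
Qed.

(** * The action of the derivation on rho, theta and P *)

Definition kappa : {poly K} := 'X * ('X - 1).

(** Differentiate [rho B ^ 2 = A ^ 2] and insert [theta_ode], after clearing denominators by
    [th ^ 6 = B ^ 3]. *)
Lemma D_rho : D rho = phi kappa * th ^+ 4.
Proof.
apply: (@th_inj 6).
have HB : th ^+ 2 = thB K by [].
have HA : rho * thB K ^+ 2 = thA K ^+ 2 by rewrite -rho_thB /thB -exprM.
have := congr1 D HA; rewrite fDM (fDX (thB K) 1) (fDX (thA K) 1) !expr1 => E.
rewrite /kappa rmorphM rmorphB /= phiX rmorph1.
have ode := theta_ode (two_neq0 m_gt0 pcharK).
have -> : th ^+ 6 = thB K ^+ 3 by rewrite /thB -exprM.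
have -> : th ^+ 4 = thB K ^+ 2 by rewrite /thB -exprM.
transitivity (thA K * (thA K * thB K * (thA K ^+ 2 - thB K ^+ 2))); last first.
  transitivity (rho * thB K ^+ 2 * (rho * thB K ^+ 2 - thB K ^+ 2) * thB K); last by ring.
  by rewrite HA; ring.
rewrite -ode.
transitivity ((D rho * thB K ^+ 2 + rho * (2%:R * thB K * D (thB K))) * thB K
   - (rho * thB K ^+ 2) * 2%:R * D (thB K)); first by ring.
by rewrite E HA; ring.
Qed.

(** This is [hasse_theta] with [B ^ (2 m) = th ^ (4 m)] factored out. *)
Lemma th_phi : th ^+ (4 * m) * phi G = fconst c.
Proof.
rewrite -(hasse_theta m_gt0 pcharK) /hasse /hpoly poly_def rmorph_sum mulr_sumr.
apply: eq_bigr => j _; rewrite /= phiZ rmorphXn /= phiX -(rmorph_nat (@fconst K)).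
have lejm : (j <= m)%N by rewrite -ltnS.
have -> : th ^+ (4 * m) = (th ^+ 4) ^+ j * thB K ^+ (2 * (m - j)).
  by rewrite /thB -!exprM -exprD; congr (_ ^+ _); lia.
rewrite [thA K ^+ _]exprM -rho_thB [(_ * th ^+ 4) ^+ j]exprMn; ring.
Qed.

Lemma natr_fps n : n%:R = fconst n%:R :> fps K.
Proof. by rewrite rmorph_nat. Qed.

Lemma D_thX n : D (th ^+ n) = n%:R * th ^+ n * P * D th.
Proof.
case: n => [|n]; first by rewrite expr0 fD1 !mul0r.
by rewrite fDX exprS -!mulrA [th * _]mulrCA [th * _]mulrA [th * P]mulrC Pgf_theta mul1r !mulrA.
Qed.

Lemma natr4m : (4 * m)%:R = - 2%:R :> K.
Proof.
rewrite (_ : 4 * m = 2 * (2 * m))%N; last by lia.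
by rewrite natrM natrM (two_m pcharK) mulrN1.
Qed.

(** Differentiating [th_phi], where [4 m = -2] in [K], expresses [2 G(rho) D th]; multiplication by
    [th ^ (4 m)] turns [G(rho)] into the constant. *)
Lemma D_th : fconst (2%:R * c) * D th = th ^+ M.+1 * phi (kappa * G^`()).
Proof.
have := congr1 D th_phi; rewrite fDM fD_const D_thX D_phi D_rho natr_fps natr4m => E.
rewrite rmorphM /= -th_phi rmorph_nat rmorphM /=.
have -> : th ^+ M.+1 = th ^+ (4 * m) * th ^+ 4 * th by rewrite mulnS addnC exprSr exprD.
rewrite rmorphN rmorph_nat in E.
transitivity (- (- 2%:R * th ^+ (4 * m) * P * D th * phi G) * th + 2%:R * th ^+ (4 * m) * phi G * D th * (1 - P * th)).
  by ring.
have -> : - 2%:R * th ^+ (4 * m) * P * D th * phi G =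
  - (th ^+ (4 * m) * (phi G^`() * (phi kappa * th ^+ 4))).
  by apply/eqP; rewrite -addr_eq0 E.
by rewrite Pgf_theta subrr mulr0 addr0; ring.
Qed.

Lemma D_P : fconst (2%:R * c) * D P = - (P * th ^+ M * phi (kappa * G^`())).
Proof.
have := congr1 D (Pgf_theta K); rewrite fDM fD1 => E.
have -> : D P = - (P ^+ 2 * D th).
  apply/eqP; rewrite -addr_eq0; apply/eqP.
  transitivity ((D P * th + P * D th) * P + D P * (1 - P * th)); first by ring.
  by rewrite E Pgf_theta subrr mulr0 addr0 mul0r.
transitivity (- (P ^+ 2 * (fconst (2%:R * c) * D th))); first by ring.
rewrite D_th [th ^+ _]exprSr.
transitivity (- (P * th ^+ M * phi (kappa * G^`()) * (P * th))); first by ring.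
by rewrite Pgf_theta mulr1.
Qed.

(** The polynomial [p_j]. In [2 i - 1], the term [2 i] is the exponent [i * M] of theta read in [K],
    and [-1] comes from the factor [P]. *)
Fixpoint dpoly (j : nat) : {poly K} :=
  if j is i.+1 then (2%:R * c)^-1 *: (kappa *
     (((2 * i)%:R - 1) *: (G^`() * dpoly i) + 2%:R *: (G * (dpoly i)^`())))
  else 1.

Lemma two_c_neq0 : 2%:R * c != 0.
Proof. by rewrite mulf_neq0 ?(hconst_neq0 m_gt0 pcharK) ?(two_neq0 m_gt0 pcharK). Qed.

Lemma iterD_P j : iter j D P = P * th ^+ (j * M) * phi (dpoly j).
Proof.
elim: j => [|j IH]; first by rewrite rmorph1 mul0n expr0 !mulr1.
have cst (x y : fps K) : fconst (2%:R * c) * x = fconst (2%:R * c) * y -> x = y.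
  move=> E; rewrite -[x]mul1r -[y]mul1r -(rmorph1 (@fconst K)) -(mulVf two_c_neq0).
  by rewrite rmorphM -!mulrA E.
apply: cst; rewrite iterS IH !fDM D_thX D_phi D_rho.
rewrite [RHS]mulrCA [dpoly j.+1]/= phiZ [fconst _ * (fconst _ * _)]mulrA.
rewrite -[fconst _ * fconst _]rmorphM mulfV ?two_c_neq0 // rmorph1 mul1r.
have EM : (j * M)%:R = fconst (2%:R * j%:R) :> fps K.
  rewrite natr_fps natrM mulrC mulnS natrD natr4m; congr (fconst (_ * _)); ring.
set p := dpoly j; have Dt := D_th; have DP := D_P.
(* This brings the term from [D rho] to the same power of [th] as the terms from [D P] and
   [D th]. *)
have T4 : fconst (2%:R * c) * th ^+ 4 = 2%:R * th ^+ M * phi G.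
  by rewrite rmorphM /= -th_phi rmorph_nat mulnS exprD; ring.
rewrite EM [(j.+1 * _)%N]mulSn exprD.
transitivity ((fconst (2%:R * c) * D P) * th ^+ (j * M) * phi p
  + P * (fconst (2%:R * j%:R) * th ^+ (j * M) * P * (fconst (2%:R * c) * D th)) * phi p
  + P * th ^+ (j * M) * (phi p^`() * (phi kappa * (fconst (2%:R * c) * th ^+ 4)))).
  by ring.
have EC : fconst ((2 * j)%:R - 1) = 2%:R * j%:R - 1 :> fps K.
  by rewrite rmorphB rmorph1 /= rmorph_nat natrM.
have EF : fconst (2%:R * j%:R) = 2%:R * j%:R :> fps K by rewrite rmorphM !rmorph_nat.
rewrite Dt DP T4 [th ^+ M.+1]exprSr [phi (kappa * (_ + _))]rmorphM /= [phi (_ + _)]rmorphD /= !phiZ EC EF rmorph_nat !rmorphM /=.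
have <- : phi kappa = phi 'X * phi ('X - 1) by rewrite rmorphM.
set F := 2%:R * j%:R.
transitivity (P * (th ^+ M * th ^+ (j * M)) * (phi kappa * ((F * (P * th) - 1) * (phi G^`() * phi p) + 2%:R * (phi G * phi p^`())))); first by ring.
by rewrite Pgf_theta mulr1.
Qed.

(** * Contradiction at a supersingular point *)

Variables (a x0 : K).
Hypothesis a_neq0 : a != 0.
Hypothesis Gx0 : root G x0.

Lemma x0_neq0 : x0 != 0.
Proof.
by apply: contraTneq Gx0 => ->; rewrite /root hpoly_root0 oner_eq0.
Qed.

Lemma x0_neq1 : x0 != 1.
Proof. by apply: contraTneq Gx0 => ->; rewrite /root (hconst_neq0 m_gt0 pcharK). Qed.

(** At a root of [G] the recursion only multiplies by nonzero values and by [2 i - 1], which first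
    vanishes in [K] at [i = m + 1]. *)
Lemma dpoly_x0 j : (j <= m.+1)%N -> (dpoly j).[x0] != 0.
Proof.
elim: j => [|j IH] ltj; first by rewrite hornerE oner_eq0.
rewrite /= hornerZ hornerM hornerD !hornerZ [(G^`() * _).[_]]hornerM [(G * _).[_]]hornerM (rootP Gx0) mul0r mulr0 addr0.
have G'x0 : G^`().[x0] != 0 by apply: hpoly_simple => //; [exact: x0_neq0 | exact: x0_neq1].
apply: mulf_neq0; first by rewrite invr_neq0 ?two_c_neq0.
apply: mulf_neq0.
  by rewrite !hornerE mulf_neq0 ?x0_neq0 // subr_eq0 x0_neq1.
apply: mulf_neq0; last by rewrite mulf_neq0 // IH // ltnW.
case: j ltj {IH} => [|j] ltj; first by rewrite muln0 sub0r oppr_eq0 oner_eq0.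
rewrite (_ : 2 * j.+1 = (2 * j).+1.+1)%N; last by lia.
by rewrite -natr1 addrK (natr_lt_neq0 pcharK) //; lia.
Qed.

Lemma relation_neq0 : \sum_(0 <= i < 2 * m) fconst (a ^+ i) * iter (2 * m - i) D P != 0.
Proof.
apply/eqP => rel0.
(* Multiplying the relation by [th * P ^ (2 m M)] leaves [P ^ (i M) = (w ^ m) ^ i * w ^ i] in the
   term [i], whence the factor [g ^ i]. *)
pose w := P ^+ 4; pose g := c^-1 *: G; pose R i := a ^+ i *: (g ^+ i * dpoly (2 * m - i)).
have wm : w ^+ m = phi g.
  rewrite /g phiZ; apply: (@th_inj (4 * m)); rewrite -exprM P_th -mulrA [phi _ * _]mulrC th_phi.
  by rewrite -rmorphM mulVf ?rmorph1 ?(hconst_neq0 m_gt0 pcharK).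
have relR : \sum_(0 <= i < 2 * m) phi (R i) * w ^+ i = 0.
  have := congr1 (fun f => f * (th * P ^+ (2 * m * M))) rel0; rewrite mul0r mulr_suml => E.
  rewrite -[RHS]E; apply: eq_big_nat => i /andP[_ lti]; rewrite iterD_P /R phiZ rmorphM /= [phi (g ^+ i)]rmorphXn /= -wm.
  have -> : P ^+ (2 * m * M) = w ^+ m ^+ i * w ^+ i * P ^+ ((2 * m - i) * M).
    rewrite /w -!exprM -!exprD; congr (_ ^+ _).
    have -> : (2 * m * M = (2 * m - i) * M + i * M)%N by rewrite -mulnDl subnK // ltnW.
    by lia.
  transitivity (fconst (a ^+ i) * (w ^+ m ^+ i * phi (dpoly (2 * m - i))) * w ^+ i *
     ((P ^+ ((2 * m - i) * M) * th ^+ ((2 * m - i) * M)) * (P * th))); last by ring.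
  by rewrite P_th Pgf_theta !mulr1.
have [h0 EG] := factor_theorem G x0 Gx0.
(* The exponents from [m] on are folded back by [w ^ m = phi g]. *)
have relQ : \sum_(0 <= i < m) phi (R i + g * R (i + m)%N) * w ^+ i = 0.
  transitivity (\sum_(0 <= i < m) phi (R i) * w ^+ i + \sum_(0 <= i < m) phi (R (i + m)%N) * w ^+ (i + m)).
    rewrite -big_split; apply: eq_big_nat => i _ /=.
    by rewrite rmorphD rmorphM /= -wm exprD; ring.
  rewrite -[RHS]relR [RHS](@big_cat_nat _ _ _ m) //; last by lia.
  have := big_addn 0 (2 * m) m xpredT (fun i => phi (R i) * w ^+ i).
  by rewrite add0n (_ : 2 * m - m = m)%N => [->//|]; lia.
have h0x0 : h0.[x0] != 0.
  have := hpoly_simple m_gt0 pcharK Gx0 x0_neq0 x0_neq1.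
  by rewrite EG derivM derivXsubC hornerD !hornerM !hornerE subrr mulr0 add0r.
have cV : c^-1 != 0 by rewrite invr_neq0 ?(hconst_neq0 m_gt0 pcharK).
have gE : g = ('X - x0%:P) * (c^-1 *: h0) by rewrite /g EG mulrC -scalerAr.
have hx0 : (c^-1 *: h0).[x0] != 0 by rewrite hornerZ mulf_neq0.
have reg s : phi ('X - x0%:P) * s = 0 -> s = 0.
  by apply: fmul_eq0_unit; rewrite phi_coef0 !hornerE subr_eq0 eq_sym x0_neq1.
have ltm : (m.-1 < m)%N by rewrite prednK.
have := @rel_free K (fps K) phi m w g (c^-1 *: h0) x0 m_gt0 wm gE hx0 reg phi_inj _ relQ m.-1 ltm.
have gN : g != 0.
  by rewrite /g scaler_eq0 negb_or cV -size_poly_gt0 size_hpoly.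
(* The index [m - 1] pairs [p_(m+1)] with [p_1]; after division by [g ^ (m - 1)] the second term
   still contains [g] and vanishes at [x0]. *)
have -> : R m.-1 + g * R (m.-1 + m)%N =
   g ^+ m.-1 * (a ^+ m.-1 *: dpoly m.+1 + a ^+ (m.-1 + m) *: (g * g ^+ m * dpoly 1)).
  rewrite /R (_ : 2 * m - m.-1 = m.+1)%N; last by lia.
  rewrite (_ : 2 * m - (m.-1 + m) = 1)%N; last by lia.
  by rewrite [g ^+ (_ + _)]exprD -!mul_polyC; ring.
move/eqP; rewrite mulf_eq0 expf_eq0 (negPf gN) andbF => /eqP/(congr1 (horner^~ x0)).
have := dpoly_x0 (leqnn m.+1); move: (dpoly m.+1) (dpoly 1) => d e /negPf d0.
have gx0 : g.[x0] = 0 by rewrite hornerZ (rootP Gx0) mulr0.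
rewrite horner0 hornerD !hornerZ !hornerM gx0 !mul0r mulr0 addr0 => /eqP.
by rewrite mulf_eq0 expf_eq0 (negPf a_neq0) andbF d0.
Qed.
End Nonvanishing.

(** The coefficient at [n] is [P_n] times the sum of [r ^ i n ^ (2 m - i)]. For [n] different from
    [r] in [K], multiplying this sum by [n - r] gives [n ^ (2 m + 1) - n r ^ (2 m)], which is 0 by
    Fermat. *)
Lemma relation_of_vanishing (K : fieldType) (m r : nat) :
  (0 < m)%N -> (2 * m).+1 \in [pchar K] -> r%:R != 0 :> K ->
  (forall n, n%:R = r%:R :> K -> Pgf K n = 0) ->
  \sum_(0 <= i < 2 * m) fconst (r%:R ^+ i) * iter (2 * m - i) (@fD K) (Pgf K) = 0.
Proof.
move=> m_gt0 pcharK r0 van; apply: fpsP => n; rewrite fcoef_sum fcoef0.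
have itD j : iter j (@fD K) (Pgf K) n = n%:R ^+ j * Pgf K n.
  by elim: j => [|j IH]; rewrite ?mul1r // iterS fcoef_fD IH mulrA -exprS.
have [E|nE] := eqVneq (n%:R : K) r%:R.
  by rewrite big1 // => i _; rewrite fcoefZ itD van ?mulr0.
rewrite (eq_big_nat _ _ (F2 := fun i => n%:R * Pgf K n * (n%:R ^+ ((2 * m).-1 - i) * r%:R ^+ i))).
  have nr : n%:R - r%:R != 0 :> K by rewrite subr_eq0.
  rewrite -mulr_sumr big_mkord; apply: (mulfI nr); rewrite mulrCA -subrXX mulr0.
  rewrite (natf_exp2m pcharK r0) mulrAC mulrBr mulr1 -exprS natf_expl //.
  by rewrite subrr mul0r.
move=> i /andP[_ lti]; rewrite fcoefZ itD (_ : 2 * m - i = ((2 * m).-1 - i).+1)%N; last by lia.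
by rewrite exprS; ring.
Qed.

(* Conclusion over an algebraic closure of the prime field *)
Local Close Scope ring_scope.

Theorem theorem1p2 (l : nat) (l_prime : prime l) (l_ge3 : 3 <= l) :
  ~ exists a : int, forall n : int, pbar (l%:Z * n + a)%R = 0 %[mod l].
Proof.
case=> a van.
have [m Em] : exists m, l = (2 * m).+1.
  by exists l./2; case: (even_prime l_prime); lia.
have m_gt0 : 0 < m by lia.
(* An algebraically closed field provides a root of the Hasse polynomial. *)
have [K [F _]] := countable_algebraic_closure 'F_l.
have pcharl : l \in [pchar K]%R by rewrite (fmorph_pchar F) pchar_Fp.
have pcharK : (2 * m).+1 \in [pchar K]%R by rewrite -Em.
pose r := `|(a %% l)%Z|%N.
have ltr : r < l by lia.
have vanK n : (n%:R = r%:R :> K -> Pgf K n = 0)%R.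
  move=> E; have {}E : n %% l = r.
    have {}E : ((n %% l)%:R = r%:R :> K)%R by rewrite (GRing.natr_mod_pchar pcharl).
    have ltn : n %% l < l by rewrite ltn_mod; lia.
    have N k : k < l -> (k%:R == 0 :> K)%R -> k = 0.
      by rewrite -(dvdn_pcharf pcharl); case: k => // k ltk; rewrite gtnNdvd.
    case: (leqP r (n %% l)) => h.
      suff : n %% l - r = 0 by lia.
      by apply: N; rewrite ?natrB ?E ?subrr //; lia.
    suff : r - n %% l = 0 by lia.
    by apply: N; rewrite ?natrB ?E ?subrr ?(ltnW h) //; lia.
  have [t Et] : exists t : int, (n%:Z = l%:Z * t + a)%R.
    (* As [n] and [a] have the same remainder, [t] is the difference of their quotients. *)
    exists ((n %/ l)%:Z - (a %/ l)%Z)%R; have := divz_eq a l; have := divn_eq n l.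
    have : (0 <= (a %% l)%Z)%R by apply: modz_ge0; lia.
    by rewrite E mulrBr => h En Ea; rewrite {1}En {2}Ea PoszD PoszM /r gez0_abs //; ring.
  have := van t; rewrite -Et /= => h; apply/eqP.
  by rewrite -(dvdn_pcharf pcharl) /dvdn h mod0n.
(* The zero class is excluded by the constant term of [P], which is 1. *)
have [r0|r0] := eqVneq (r%:R : K)%R 0%R.
  have := vanK 0; rewrite r0 => /(_ erefl) /eqP.
  by rewrite -[Pgf K 0]/(_%:R)%R (num_overpartitions_opgf K (leqnn 0)) fcoef1 oner_eq0.
have [x0 Gx0] : exists x0, root (hpoly K m) x0.
  by apply/closed_rootP; rewrite size_hpoly eqSS -lt0n.
have := relation_neq0 m_gt0 pcharK r0 Gx0.
by rewrite relation_of_vanishing // eqxx.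
Qed.
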